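(* Let $P$ be a nonzero polynomial on $\mathbb{R}^n$, and define $$N_P:=\sup\{d(P\cdot h): h\in\mathcal{P}\text{ is a harmonic polynomial}\}.$$ Let $\mu$ and $\nu$ be finite signed Borel measures on $\mathbb{R}^n$ whose supports are contained in $K_P(R)=\{x\in\mathbb{R}^n: P(x)=0\text{ and }|x|\le R\}$ for some $R>0$. Then $\mu=\nu$ if and only if $\int h\,d\mu=\int h\,d\nu$ for all polynomials $h$ in the subspace $$U_{N_P}:=\{Q\in\mathcal{P}:\ \Delta^{N_P}Q=0\}.$$
   Context: $\mathcal{P}$ denotes the set of all polynomials in $n$ real variables $x=(x_1,\dots,x_n)$ with complex coefficients; $|x|$ is the euclidean norm. $\Delta=\sum_{i=1}^n\partial^2/\partial x_i^2$ is the Laplace operator, $\Delta^N$ its $N$-th iterate ($\Delta^0$ is the identity), and a polynomial $h$ is harmonic if $\Delta h=0$. The polyharmonic degree of a polynomial $f$ is $d(f):=\min\{N\in\mathbb{N}_0:\Delta^{N+1}f=0\}$. (The supremum $N_P$ is finite; in fact it is at most the total degree of $P$.) *)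

(* Defs.v *)
From HB Require Import structures.
From mathcomp Require Import all_boot all_order all_algebra complex.
From mathcomp Require Import all_classical all_reals all_analysis.
From mathcomp Require mpoly.
(* Importing the notations of mpoly clashes with those of MathComp-Analysis. *)
Import -(notations) mpoly.

Set Implicit Arguments.
Unset Strict Implicit.
Unset Printing Implicit Defensive.

Import Order.TTheory GRing.Theory Num.Theory.
Import numFieldNormedType.Exports.

Local Open Scope classical_set_scope.
Local Open Scope complex_scope.
Local Open Scope ring_scope.

Section Polynomials.
Variables (R : realType) (n : nat).
Implicit Types (f h P Q : mpoly n R[i]).

Definition laplacian f : mpoly n R[i] := \sum_(i < n) mderiv i (mderiv i f).

Definition harmonic f : Prop := laplacian f = 0.

Definition polyharmonic_space (N : nat) : set (mpoly n R[i]) :=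
  [set Q | iter N laplacian Q = 0].

Lemma laplacian0 : laplacian 0 = 0.
Proof. by rewrite /laplacian big1 // => i _; rewrite !mderiv0. Qed.

Lemma laplacianD f h : laplacian (f + h) = laplacian f + laplacian h.
Proof. by rewrite /laplacian -big_split; apply: eq_bigr => i _; rewrite !mderivD. Qed.

Lemma iter_laplacian0 N : iter N laplacian 0 = 0.
Proof. by elim: N => // N IH; rewrite iterS IH laplacian0. Qed.

Lemma iter_laplacianD N f h :
  iter N laplacian (f + h) = iter N laplacian f + iter N laplacian h.
Proof. by elim: N => // N IH; rewrite !iterS IH laplacianD. Qed.

Lemma iter_laplacian_sum N (F : 'I_n -> mpoly n R[i]) :
  iter N laplacian (\sum_i F i) = \sum_i iter N laplacian (F i).
Proof.
exact: (big_morph _ (iter_laplacianD N) (iter_laplacian0 N)).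
Qed.

Lemma mderiv_laplacian i f : mderiv i (laplacian f) = laplacian (mderiv i f).
Proof.
rewrite /laplacian raddf_sum; apply: eq_bigr => j _ /=.
by rewrite mderiv_comm [mderiv i (mderiv j f)]mderiv_comm.
Qed.

Lemma laplacianM f h : laplacian (f * h) =
  laplacian f * h + (\sum_i mderiv i f * mderiv i h) *+ 2 + f * laplacian h.
Proof.
rewrite /laplacian mulr_suml mulr_sumr -sumrMnl -!big_split /=.
apply: eq_bigr => i _; rewrite mderivM mderivD !mderivM mulr2n.
by rewrite !addrA.
Qed.

Lemma mcoeff_mderiv_eq0 i f k :
  (forall m, (k.+1 <= mdeg m)%N -> mcoeff m f = 0) ->
  forall m, (k <= mdeg m)%N -> mcoeff m (mderiv i f) = 0.
Proof.
by move=> fk m km; rewrite mcoeff_mderiv fk ?mul0rn // mdegD mdeg1 addn1.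
Qed.

(* The hypothesis on P says that its total degree is less than k. *)
Lemma iter_laplacian_mul_harmonic k P h :
  (forall m, (k <= mdeg m)%N -> mcoeff m P = 0) -> harmonic h ->
  iter k laplacian (P * h) = 0.
Proof.
elim: k P h => [|k IH] P h Pk hh.
  have -> : P = 0 by apply/mpolyP => m; rewrite Pk // mcoeff0.
  by rewrite mul0r.
have hderiv i : harmonic (mderiv i h).
  by rewrite /harmonic -mderiv_laplacian hh mderiv0.
have Pk1 i := mcoeff_mderiv_eq0 i Pk.
rewrite iterSr laplacianM hh mulr0 addr0 iter_laplacianD /laplacian mulr_suml.
rewrite mulr2n !iter_laplacianD !iter_laplacian_sum.
have dPdh : \sum_i iter k laplacian (mderiv i P * mderiv i h) = 0.
  by rewrite big1 // => i _; apply: IH; [exact: Pk1 | exact: hderiv].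
rewrite dPdh !addr0 big1 // => i _; apply: IH => //.
by apply: mcoeff_mderiv_eq0 => m /ltnW; exact: Pk1.
Qed.

Lemma iter_laplacian_msize f : iter (mmeasure mdeg f) laplacian f = 0.
Proof.
rewrite -[f in iter _ _ f]mulr1; apply: iter_laplacian_mul_harmonic => [m fm|].
  by apply: memN_msupp_eq0; apply: msize_mdeg_ge.
by rewrite /harmonic /laplacian big1 // => i _; rewrite -mpolyC1 mderivC mderiv0.
Qed.

Lemma polyharmonic_degree_proof f :
  exists N, iter N.+1 laplacian f == 0.
Proof. by exists (mmeasure mdeg f); rewrite iterS iter_laplacian_msize laplacian0. Qed.

Definition polyharmonic_degree f : nat := ex_minn (polyharmonic_degree_proof f).

Definition harmonic_product_degrees P : set nat :=
  [set polyharmonic_degree (P * h) | h in harmonic].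

(* [supremum] takes a default value when there is no supremum;
   [max_product_degreeP] shows that this never happens. *)
Definition max_product_degree P : nat :=
  supremum 0%N (harmonic_product_degrees P).

Lemma polyharmonic_degree_le P h :
  harmonic h -> (polyharmonic_degree (P * h)%R <= (mmeasure mdeg P).-1)%N.
Proof.
move=> hh; rewrite /polyharmonic_degree; case: ex_minnP => N _; apply.
apply/eqP/iter_laplacian_mul_harmonic => // m Pm.
by apply: memN_msupp_eq0; apply: msize_mdeg_ge; apply: leq_trans Pm; exact: leqSpred.
Qed.

Lemma max_product_degreeP P :
  supremums (harmonic_product_degrees P) (max_product_degree P).
Proof.
have D0 : harmonic_product_degrees P (polyharmonic_degree (P * 0)).
  by exists 0 => //; exact: laplacian0.
have [s Ds] : supremums (harmonic_product_degrees P) !=set0.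
  apply: nat_supremums_neq0; exists (mmeasure mdeg P).-1 => _ [h hh <-].
  by rewrite leEnat; exact: polyharmonic_degree_le.
rewrite /max_product_degree /supremum; case: ifPn => [/eqP D|_].
  by rewrite D in D0.
by case: xgetP => [y _ //|/(_ s)].
Qed.

Lemma max_product_degree_le P : (max_product_degree P <= (mmeasure mdeg P).-1)%N.
Proof.
have [_] := max_product_degreeP P; apply => _ [h hh <-].
by rewrite leEnat; exact: polyharmonic_degree_le.
Qed.

Definition ceval f (x : 'rV[R]_n) : R[i] := meval (fun i => (x 0 i)%:C) f.

(* The norm of the normed module 'rV[R]_n is the sup norm. *)
Definition eucl_norm (x : 'rV[R]_n) : R := Num.sqrt (\sum_i x 0 i ^+ 2).

Definition zero_set_ball P (r : R) : set 'rV[R]_n :=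
  [set x | ceval P x = 0 /\ eucl_norm x <= r].

End Polynomials.

Definition borelRn (R : realType) (n : nat) := g_sigma_algebraType (@open 'rV[R]_n).

Section SignedMeasures.
Context d (T : measurableType d) (R : realType).
Implicit Types (mu nu : {charge set T -> \bar R}).

Definition hahn_pos mu : set T := projT1 (cid (Hahn_decomposition mu)).

Definition hahn_neg mu : set T :=
  projT1 (cid (projT2 (cid (Hahn_decomposition mu)))).

Definition hahnP mu : hahn_decomposition mu (hahn_pos mu) (hahn_neg mu) :=
  projT2 (cid (projT2 (cid (Hahn_decomposition mu)))).

(* Integral against mu = mu^+ - mu^-; by uniqueness of the Jordan decomposition
   it does not depend on the chosen Hahn decomposition. *)
Definition charge_integral mu (f : T -> R) : R :=
  \int[jordan_pos (hahnP mu)]_x f x - \int[jordan_neg (hahnP mu)]_x f x.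

Definition charge_cintegral mu (f : T -> R[i]) : R[i] :=
  charge_integral mu (fun x => complex.Re (f x)) +i*
  charge_integral mu (fun x => complex.Im (f x)).

(* Charges take finite values on measurable sets, but as functions on all sets
   they are unconstrained off the sigma-algebra. *)
Definition eq_charge mu nu : Prop := forall A, measurable A -> mu A = nu A.

End SignedMeasures.

(* Complement of the union of the open sets that are null for |mu|. *)
Definition charge_support (R : realType) (n : nat)
    (mu : {charge set (borelRn R n) -> \bar R}) : set 'rV[R]_n :=
  [set x | forall U : set 'rV[R]_n, open U -> U x ->
    charge_variation (hahnP mu) U != 0%E].

(* Main.v *)
From HB Require Import structures.
Require Import Defs.
From mathcomp Require Import all_boot all_order all_algebra complex.
From mathcomp Require Import all_classical all_reals all_analysis.
From mathcomp Require mpoly.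
Import -(notations) mpoly.
From mathcomp Require Import measurable_realfun ring lra.

Set Implicit Arguments.
Unset Strict Implicit.
Unset Printing Implicit Defensive.

Import Order.TTheory GRing.Theory Num.Theory.
Import numFieldNormedType.Exports.

Local Open Scope classical_set_scope.
Local Open Scope ring_scope.

(** Two charges that agree have the same integrals. For the converse, the
    difference of the two integrals is a linear functional ell on polynomials; it
    vanishes on all multiples of P, because the charges live on the zero set of P,
    and on the kernel of the N-th power of the Laplacian, N being the maximal
    polyharmonic degree of P times a harmonic polynomial. Then ell = 0
    ([fischer_functional_eq0]), that is, all moments of the two charges agree, and
    compactly supported charges are determined by their moments
    ([moments_unique]).

    Why ell = 0. Let rho be the sum of the squares of the variables, and call its
    complex zero set the cone. Write the leading form of P as rho^j q with q not
    divisible by rho, homogeneous of degree b. By the Nullstellensatz for the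
    quadric rho there is a point v of the cone with q(v) <> 0 (in one variable
    q = c x is the exceptional case). The powers of the linear form with
    coefficient vector v are harmonic, and the product of P with the b-th one has
    polyharmonic degree at least b + j, so N >= b + j ([max_product_degree_ge]).

    The moments of ell of degree d are the coefficients of a homogeneous
    polynomial F, up to factorials, with ell f = f(D) F for f homogeneous of
    degree d. Let d be minimal with F <> 0. Since ell kills the multiples of P, the
    leading form of P gives q(D) Lap^j F = 0; since ell kills ker Lap^(b + j),
    Fischer duality shows that rho^(b + j) divides F
    ([fischer_orthogonal_polyharmonic]). Hence Lap^j F vanishes to the order b on
    the cone and is a solution of the equation q(D) u = 0 of order b. The gradient
    of rho at v is 2v, so q(v) <> 0 says that the cone is noncharacteristic at v;
    zero Cauchy data then force Lap^j F = 0 ([diffop_rho_uniqueness], by an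
    algebraic order-of-vanishing argument). Finally Lap^j is injective on the
    homogeneous multiples of rho^j, so F = 0, a contradiction.

    Why moments suffice. The polynomials (1 - u^k)^(k 2^k) converge boundedly on
    [0, 1] to the indicator of u < 1/2. Composed with polynomials and multiplied,
    they make the indicators of boxes bounded pointwise limits of polynomials on
    a cube; boxes generate the Borel sets, and dominated convergence together
    with the uniqueness theorem for measures on a pi-system concludes. *)

(** * The Laplacian and the squared norm *)

Section Algebra.
Context {R : realType} {n : nat}.
Local Notation C := R[i].
Implicit Types (f g h p q u F G P : mpoly n C) (v : 'I_n -> C).
Implicit Types (i : 'I_n) (m : multinom n) (d k s t : nat).
Local Notation Xv i := (mpolyX C (mnm1 i)).
Local Notation Xm m := (mpolyX C m).
Local Notation lap := (@laplacian R n).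
Local Notation hom d := (ishomog1 d mdeg).

(** The squared euclidean norm. Its zeros over the complex numbers form the isotropic cone. *)
Definition rho : mpoly n C := \sum_i Xv i ^+ 2.

Lemma natC_neq0 k : (k.+1%:R : C) != 0.
Proof. by rewrite pnatr_eq0. Qed.

Lemma hom_coef d f m : f \is hom d -> mcoeff m f != 0 -> mdeg m = d.
Proof. by move=> /dhomogP H; rewrite -mcoeff_msupp => /H. Qed.

Lemma homI d f : (forall m, mcoeff m f != 0 -> mdeg m = d) -> f \is hom d.
Proof. by move=> H; apply/dhomogP => m; rewrite mcoeff_msupp => /H. Qed.

Lemma homM d d' f g : f \is hom d -> g \is hom d' -> f * g \is hom (d + d').
Proof. exact: dhomogM. Qed.

Lemma hom_Xv i : Xv i \is hom 1.
Proof. by rewrite dhomogX /= mdeg1. Qed.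

Lemma hom_rho : rho \is hom 2.
Proof. by apply: rpred_sum => i _; rewrite expr2; apply: (@homM 1 1); exact: hom_Xv. Qed.

Lemma mderivXv i j : mderiv i (Xv j) = (i == j)%:R.
Proof.
rewrite mderivX mnm1E eq_sym; case: eqP => [->|_]; last by rewrite scale0r.
by rewrite scale1r (_ : mnm_sub _ _ = @mnm0 n) ?mpolyX0 //; apply/mnmP => k; rewrite !mnmE subnn.
Qed.

Lemma mderiv_rho i : mderiv i rho = Xv i *+ 2.
Proof.
rewrite /rho raddf_sum /= (bigD1 i) //= big1 ?addr0.
  by rewrite expr2 mderivM mderivXv eqxx mul1r mulr1 mulr2n.
by move=> j /negbTE ij; rewrite expr2 mderivM mderivXv eq_sym ij mul0r mulr0 addr0.
Qed.

Lemma hom_mderiv d f i : f \is hom d -> mderiv i f \is hom d.-1.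
Proof.
move=> fd; apply: homI => m; rewrite mcoeff_mderiv => H.
have /(hom_coef fd) : mcoeff (mnm_add m (mnm1 i)) f != 0.
  by apply: contraNneq H => ->; rewrite mul0rn.
by rewrite mdegD mdeg1 addn1 => <-.
Qed.

Lemma hom_laplacian d f : f \is hom d -> laplacian f \is hom (d - 2).
Proof.
move=> fd; apply: rpred_sum => i _.
by rewrite subn2; apply: hom_mderiv; exact: hom_mderiv.
Qed.

Lemma hom_iter_laplacian k d f : f \is hom d -> iter k lap f \is hom (d - 2 * k).
Proof.
move=> fd; elim: k => [|k IH]; first by rewrite muln0 subn0.
by rewrite iterS mulnS addnC subnDA; exact: hom_laplacian.
Qed.

Lemma laplacian_is_linear : linear lap.
Proof.
move=> c f g; rewrite /laplacian scaler_sumr -big_split /=.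
by apply: eq_bigr => i _; rewrite !linearP.
Qed.

HB.instance Definition _ := GRing.isLinear.Build C (mpoly n C) (mpoly n C) _
  lap laplacian_is_linear.

Lemma iter_laplacianMn k f c :
  iter k lap (f *+ c) = iter k lap f *+ c.
Proof. by elim: k => // k IH; rewrite !iterS IH raddfMn. Qed.

Lemma iter_laplacian_leq k s f :
  (k <= s)%N -> iter k lap f = 0 -> iter s lap f = 0.
Proof. by move=> /subnK <- fk; rewrite iterD fk iter_laplacian0. Qed.

Lemma euler d f : f \is hom d -> \sum_i Xv i * mderiv i f = f *+ d.
Proof.
move=> fd; rewrite {2}(mpolyE f) -sumrMnl.
under eq_bigr do rewrite {1}(mpolyE f) raddf_sum mulr_sumr /=.
rewrite exchange_big /= big_seq [RHS]big_seq; apply: eq_bigr => m mf.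
have <- : mdeg m = d by apply: (hom_coef fd); rewrite -mcoeff_msupp.
rewrite mdegE -sumrMnr; apply: eq_bigr => i _.
rewrite mderivZ mderivX -!scalerAr scaler_nat scalerMnr; congr (_ *: _).
have [->|mi] := eqVneq (m i) 0%N; first by rewrite !mulr0n.
by rewrite -mpolyXD addmC submK // lep1mP.
Qed.

Lemma laplacian_rho : laplacian rho = (2 * n)%:R.
Proof.
rewrite /laplacian.
under eq_bigr do rewrite mderiv_rho raddfMn /= mderivXv eqxx.
by rewrite sumr_const card_ord -mulrnA.
Qed.

Lemma laplacian_rhoM d f : f \is hom d ->
  laplacian (rho * f) = rho * laplacian f + f *+ (2 * n + 4 * d).
Proof.
move=> fd; rewrite laplacianM laplacian_rho.
under eq_bigr do rewrite mderiv_rho mulrnAl.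
rewrite sumrMnl (euler fd) -!mulrnA mulr_natl -mulrnDr [RHS]addrC.
by rewrite (mulnC d).
Qed.

(** Moving one Laplacian across rho adds the polynomial with the factor
    2 n + 4 d, where d is its degree; the positive constant collects these factors
    over the t + 1 Laplacians. *)
Lemma iter_laplacian_rhoM t d f : (0 < n)%N -> f \is hom d ->
  exists c, iter t.+1 lap (rho * f) =
    rho * iter t.+1 lap f + iter t lap f *+ c.+1.
Proof.
move=> n0 fd; elim: t => [|t [c IH]].
  exists (2 * n + 4 * d).-1; rewrite prednK ?addn_gt0 ?muln_gt0 ?n0 //.
  exact: laplacian_rhoM.
exists (2 * n + 4 * (d - 2 * t.+1) + c)%N.
rewrite iterS IH linearD raddfMn /= (laplacian_rhoM (hom_iter_laplacian t.+1 fd)).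
by rewrite -addrA !iterS -mulrnDr addnS.
Qed.

Lemma laplacian_nilpotent f : f != 0 ->
  exists t, iter t lap f != 0 /\ iter t.+1 lap f = 0.
Proof.
move=> f0.
have /ex_minnP[k /eqP fk kmin] : exists k, iter k lap f == 0.
  by exists (mmeasure mdeg f); rewrite iter_laplacian_msize.
case: k fk kmin => [|k] fk kmin; first by rewrite /= in fk; rewrite fk eqxx in f0.
by exists k; split => //; apply/negP => /kmin; rewrite ltnn.
Qed.

(** At the last nonzero iterate of the Laplacian, the commutator formula keeps
    only the term with a positive constant. So each factor rho raises the
    polyharmonic degree of a homogeneous polynomial by exactly one. *)
Lemma iter_laplacian_rhoX t j d f : (0 < n)%N -> f \is hom d ->
  iter t lap f != 0 -> iter t.+1 lap f = 0 ->
  iter (t + j) lap (rho ^+ j * f) != 0 /\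
  iter (t + j).+1 lap (rho ^+ j * f) = 0.
Proof.
move=> n0 fd f1 f2; elim: j => [|j [IH1 IH2]]; first by rewrite addn0 mul1r.
have hj : rho ^+ j * f \is hom (2 * j + d).
  by apply: homM => //; exact: dhomogMn hom_rho.
rewrite exprS -mulrA; split; rewrite addnS.
  have [c ->] := iter_laplacian_rhoM (t + j) n0 hj.
  by rewrite IH2 mulr0 add0r -scaler_nat scaler_eq0 negb_or natC_neq0.
have [c ->] := iter_laplacian_rhoM (t + j).+1 n0 hj.
by rewrite iterS IH2 laplacian0 mulr0 mul0rn addr0.
Qed.

(** * Fischer duality *)

Lemma iter_laplacian_deg_lt k s f :
  (forall m, (k <= mdeg m)%N -> mcoeff m f = 0) -> (k <= 2 * s)%N ->
  iter s lap f = 0.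
Proof.
elim: s k f => [|s IH] k f fk ks.
  by apply/mpolyP => m; rewrite fk ?mcoeff0 // (leq_trans ks).
rewrite iterSr; apply: (IH (k - 2)%N) => [m|]; last first.
  by rewrite leq_subLR -mulnS.
rewrite leq_subLR add2n => km; rewrite raddf_sum /= big1 // => i _.
by rewrite !mcoeff_mderiv fk ?mul0rn // !mdegD !mdeg1 !addn1.
Qed.

Lemma iter_laplacian_hom_eq0 d s f : f \is hom d -> (d < 2 * s)%N -> iter s lap f = 0.
Proof.
move=> fd ds; apply: iter_laplacian_deg_lt ds => m dm; apply/eqP.
by apply: contraTT dm => /(hom_coef fd) ->; rewrite ltnn.
Qed.

Lemma laplacian_rhoX s d f : (0 < n)%N -> f \is hom d ->
  exists c, lap (rho ^+ s.+1 * f) = rho ^+ s.+1 * lap f + (rho ^+ s * f) *+ c.+1.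
Proof.
move=> n0 fd; elim: s => [|s [c IH]].
  rewrite expr1 expr0 mul1r; exists (2 * n + 4 * d).-1.
  by rewrite prednK ?addn_gt0 ?muln_gt0 ?n0 //; exact: laplacian_rhoM.
have hs : rho ^+ s.+1 * f \is hom (2 * s.+1 + d).
  by apply: homM => //; apply: dhomogMn; exact: hom_rho.
exists (c + (2 * n + 4 * (2 * s.+1 + d)))%N.
rewrite exprS -mulrA (laplacian_rhoM hs) IH mulrDr mulrnAr !mulrA -!exprS -addrA.
by rewrite -mulrnDr addSn.
Qed.

(** On the sequence of the rho^s Lap^s f, the map g |-> Lap (rho g) is triangular
    with nonzero diagonal entries by [laplacian_rhoX]; it is inverted by descending
    induction on s, starting where Lap^s f = 0. *)
Lemma laplacian_rho_surj d f : (0 < n)%N -> f \is hom d ->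
  exists2 g, g \is hom d & lap (rho * g) = f.
Proof.
move=> n0 fd.
suff H s j : iter (j + s) lap f = 0 ->
    exists2 g, g \is hom d & lap (rho * g) = rho ^+ s * iter s lap f.
  case: (H 0%N (mmeasure mdeg f)) => [|g].
    by rewrite addn0 iter_laplacian_msize.
  by rewrite mul1r; exists g.
elim: j s => [|j IH] s fs.
  by exists 0; [exact: rpred0|rewrite fs !mulr0 laplacian0].
have [|g gd Eg] := IH s.+1; first by rewrite addnS.
have [ds|sd] := ltnP d (2 * s).
  by exists 0; [exact: rpred0|rewrite (iter_laplacian_hom_eq0 fd ds) !mulr0 laplacian0].
have hs : rho ^+ s * iter s lap f \is hom d.
  rewrite -(subnKC sd); apply: homM; first by apply: dhomogMn; exact: hom_rho.
  exact: hom_iter_laplacian.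
have [c Ec] := laplacian_rhoX s n0 (hom_iter_laplacian s fd).
exists (c.+1%:R^-1 *: (rho ^+ s * iter s lap f - g)).
  by apply: rpredZ; apply: rpredB.
rewrite -scalerAr linearZ mulrBr linearB /= Eg mulrA -exprS Ec -iterS addrAC subrr add0r.
by rewrite -[rho ^+ s * _ *+ _]scaler_nat scalerA mulVf ?natC_neq0 // scale1r.
Qed.

(** One factor rho is split off at a time: if Lap (rho g1) = Lap f, then f - rho g1
    is harmonic, and multiplication by rho maps homogeneous elements of ker Lap^k to
    ker Lap^(k + 1). *)
Lemma fischer_decomposition k d f : (0 < n)%N -> f \is hom d ->
  exists u g, [/\ u \is hom d, g \is hom (d - 2 * k), iter k lap u = 0
    & f = u + rho ^+ k * g].
Proof.
move=> n0; elim: k d f => [|k IH] d f fd.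
  by exists 0, f; rewrite muln0 subn0 mul1r add0r; split => //; exact: rpred0.
have [d2|d2] := ltnP d 2.
  exists f, 0; rewrite mulr0 addr0; split => //; first exact: rpred0.
  by apply: (iter_laplacian_hom_eq0 fd); rewrite mulnS (leq_trans d2) // leq_addr.
have [g1 hg1 Eg1] := laplacian_rho_surj n0 (hom_laplacian fd).
have [u [g [hu hg Eu Eg]]] := IH _ _ hg1.
exists (f - rho * g1 + rho * u), g; split.
- have rd x : x \is hom (d - 2) -> rho * x \is hom d.
    by move=> hx; rewrite -(subnKC d2); apply: homM => //; exact: hom_rho.
  by rewrite rpredD ?rpredB // rd.
- by rewrite mulnS subnDA.
- have [c] := iter_laplacian_rhoM k n0 hu.
  rewrite [iter k.+1 lap u]iterS Eu laplacian0 mulr0 add0r mul0rn => Eru.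
  by rewrite iter_laplacianD Eru addr0 iterSr linearB /= Eg1 subrr iter_laplacian0.
- by rewrite -addrA exprS -mulrA -mulrDr -Eg subrK.
Qed.

Lemma mpoly_span (Q : mpoly n C -> Prop) :
  Q 0 -> (forall c f g, Q f -> Q g -> Q (c *: f + g)) -> (forall m, Q (Xm m)) ->
  forall f, Q f.
Proof. by move=> Q0 QD QX; elim/mpolyind => // c m p _ _; apply: QD. Qed.

Lemma mnm_ind (Q : multinom n -> Prop) :
  Q (@mnm0 n) -> (forall i m, Q m -> Q (mnm_add (mnm1 i) m)) -> forall m, Q m.
Proof.
move=> Q0 QS m; have [d] := ubnP (mdeg m); elim: d m => // d IH m.
have [->|m0] := eqVneq m (@mnm0 n); first by [].
have [i mi] : exists i, m i != 0%N.
  apply/existsP; apply: contraNT m0 => /existsPn H; apply/eqP/mnmP => i.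
  by rewrite mnm0E; apply/eqP; rewrite -[_ == _]negbK; exact: H.
have Em : m = mnm_add (mnm1 i) (mnm_sub m (mnm1 i)) by rewrite addmC submK // lep1mP.
rewrite {1}Em mdegD mdeg1 add1n ltnS => md.
by rewrite Em; apply/QS/IH.
Qed.

Definition mfact m : nat := \prod_i (m i)`!.

(** The Fischer pairing, the value at 0 of f(D) g: multiplication by the i-th
    variable is adjoint to the i-th partial derivative. *)
Definition fischer g f : C :=
  \sum_(m <- msupp f) mcoeff m f * (mcoeff m g * (mfact m)%:R).

Lemma fischerwE k g f : (mmeasure mdeg f <= k)%N -> fischer g f =
  \sum_(m : bmultinom n k) mcoeff m f * (mcoeff m g * (mfact m)%:R).
Proof.
move=> fk; rewrite /fischer (ssrcomplements.big_mksub (bmultinom n k)) /=; first last.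
- by move=> x /msize_mdeg_lt/leq_trans; apply.
- exact: msupp_uniq.
rewrite big_rmcond //= => m /memN_msupp_eq0 ->; by rewrite mul0r.
Qed.

Lemma fischer_is_linear g : linear_for *%R (fischer g).
Proof.
move=> c f h.
pose k := maxn (mmeasure mdeg (c *: f + h)) (maxn (mmeasure mdeg f) (mmeasure mdeg h)).
rewrite !(@fischerwE k) /k ?leq_max ?leqnn ?orbT //.
rewrite mulr_sumr -big_split /=; apply: eq_bigr => m _.
by rewrite mcoeffD mcoeffZ mulrDl -mulrA.
Qed.

HB.instance Definition _ g := GRing.isLinear.Build C (mpoly n C) C _
  (fischer g) (fischer_is_linear g).

Lemma fischerC f g : fischer f g = fischer g f.
Proof.
pose k := maxn (mmeasure mdeg f) (mmeasure mdeg g).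
rewrite !(@fischerwE k) /k ?leq_max ?leqnn ?orbT //.
by apply: eq_bigr => m _; rewrite mulrCA.
Qed.

Lemma fischerX g m : fischer g (Xm m) = mcoeff m g * (mfact m)%:R.
Proof. by rewrite /fischer msuppX big_seq1 mcoeffX eqxx mul1r. Qed.

Lemma fischer_nondeg g : (forall m, fischer g (Xm m) = 0) -> g = 0.
Proof.
move=> H; apply/mpolyP => m; rewrite mcoeff0; apply/eqP.
have /eqP := H m; rewrite fischerX mulf_eq0 pnatr_eq0 => /orP[//|/eqP E].
have : (0 < mfact m)%N by apply: prodn_gt0 => i; exact: fact_gt0.
by rewrite E.
Qed.

Lemma mfactD1 i m : mfact (mnm_add (mnm1 i) m) = ((m i).+1 * mfact m)%N.
Proof.
rewrite /mfact (bigD1 i) //= [in RHS](bigD1 i) //= mnmDE mnm1E eqxx add1n factS mulnA.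
congr (_ * _)%N; apply: eq_bigr => j ji.
by rewrite mnmDE mnm1E eq_sym (negbTE ji).
Qed.

Lemma fischer_mulXv i g f : fischer g (Xv i * f) = fischer (mderiv i g) f.
Proof.
elim/mpoly_span: f => [|c f h Ef Eh|m]; first by rewrite mulr0 !linear0.
  by rewrite mulrDr -scalerAr !linearP /= Ef Eh.
rewrite -mpolyXD !fischerX mfactD1 mcoeff_mderiv addmC natrM mulrA.
by congr (_ * _); rewrite mulr_natr.
Qed.

Lemma fischer_mulXm m g f : fischer g (Xm m * f) = fischer (mderivm m g) f.
Proof.
elim/mnm_ind: m g f => [|i m IH] g f; first by rewrite mpolyX0 mul1r mderivm0m.
by rewrite mpolyXD -mulrA fischer_mulXv IH mderivmDm mderivmU1m.
Qed.

Lemma fischer_mulrho g f : fischer g (rho * f) = fischer (lap g) f.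
Proof.
rewrite /rho mulr_suml linear_sum [RHS]fischerC linear_sum; apply: eq_bigr => i _.
by rewrite /= expr2 -mulrA !fischer_mulXv fischerC.
Qed.

Lemma fischer_mulrhoX k g f : fischer g (rho ^+ k * f) = fischer (iter k lap g) f.
Proof.
elim: k g => [|k IH] g; first by rewrite mul1r.
by rewrite exprS -mulrA fischer_mulrho IH iterSr.
Qed.

(** The differential operator p(D). *)
Definition diffop p F := \sum_(m <- msupp p) mcoeff m p *: mderivm m F.

Lemma fischer_mul p g f : fischer g (p * f) = fischer (diffop p g) f.
Proof.
rewrite {1}(mpolyE p) mulr_suml linear_sum /diffop [RHS]fischerC linear_sum.
apply: eq_bigr => m _ /=.
by rewrite -scalerAl !linearZ /= fischer_mulXm fischerC.
Qed.

Lemma fischer_hom_neq d d' f g : f \is hom d -> g \is hom d' -> d != d' -> fischer g f = 0.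
Proof.
move=> fd gd dd'; rewrite /fischer big_seq big1 // => m mf.
have md : mdeg m = d by apply: (hom_coef fd); rewrite -mcoeff_msupp.
have -> : mcoeff m g = 0; last by rewrite mul0r mulr0.
by apply/eqP; apply: contraNT dd' => /(hom_coef gd); rewrite md => ->.
Qed.

(** In the decomposition F = u + rho^k G, the component u is orthogonal to
    ker Lap^k by hypothesis and to the multiples of rho^k by adjointness, hence to
    every polynomial. *)
Lemma fischer_orthogonal_polyharmonic k d F : (0 < n)%N -> F \is hom d ->
  (forall u, u \is hom d -> iter k lap u = 0 -> fischer F u = 0) ->
  exists2 G, G \is hom (d - 2 * k) & F = rho ^+ k * G.
Proof.
move=> n0 Fd Fk; have [u [G [ud Gd uk EF]]] := fischer_decomposition k n0 Fd.
suff u0 : u = 0 by exists G => //; rewrite EF u0 add0r.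
apply: fischer_nondeg => m.
have mX : Xm m \is hom (mdeg m) by rewrite dhomogX.
have [u1 [g1 [u1d _ u1k ->]]] := fischer_decomposition k n0 mX.
rewrite linearD /= fischer_mulrhoX uk [fischer 0 _]fischerC linear0 addr0.
have [dm|dm] := eqVneq (mdeg m) d; last exact: (fischer_hom_neq u1d ud).
have -> : u = F - rho ^+ k * G by rewrite EF addrK.
rewrite fischerC linearB /= fischerC Fk ?dm // -?dm //.
by rewrite fischer_mulrhoX u1k fischerC linear0 subrr.
Qed.

(** * Uniqueness near the cone and the Nullstellensatz *)

Implicit Types (e : nat) (x y : 'I_n -> C).

Lemma poly_eq0_of_horner (a : {poly C}) : (forall t : C, a.[t] = 0) -> a = 0.
Proof.
move=> a0; apply/eqP/negPn/negP => an0.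
have := @max_poly_roots C a [seq k%:R | k <- iota 0 (size a)] an0.
rewrite size_map size_iota ltnn => H; suff : false by []; apply: H.
  by apply/allP => z /mapP[k _ ->]; rewrite /root a0.
by rewrite map_inj_uniq ?iota_uniq // => k l /eqP; rewrite eqr_nat => /eqP.
Qed.

Definition on_line x y : mpoly n C -> {poly C} :=
  mmap polyC (fun i => (x i)%:P + y i *: 'X).

Lemma on_lineM x y f g : on_line x y (f * g) = on_line x y f * on_line x y g.
Proof. exact: rmorphM. Qed.

Lemma on_lineD x y f g : on_line x y (f + g) = on_line x y f + on_line x y g.
Proof. exact: mmapD. Qed.

Lemma on_lineXn x y f k : on_line x y (f ^+ k) = on_line x y f ^+ k.
Proof. exact: rmorphXn. Qed.

Lemma on_lineZ x y (c : C) f : on_line x y (c *: f) = c *: on_line x y f.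
Proof. by rewrite /on_line mmapZ mul_polyC. Qed.

Lemma on_lineXv x y i : on_line x y (Xv i) = (x i)%:P + y i *: 'X.
Proof. by rewrite /on_line mmapX mmap1U. Qed.

Lemma horner_on_line x y f (t : C) :
  (on_line x y f).[t] = meval (fun i => x i + t * y i) f.
Proof.
elim/mpoly_span: f => [|c f g Ef Eg|m]; first by rewrite /on_line !raddf0 horner0.
  by rewrite on_lineD on_lineZ hornerD hornerZ mevalD mevalZ Ef Eg.
rewrite /on_line mmapX mevalX /mmap1 horner_prod; apply: eq_bigr => i _.
by rewrite horner_exp hornerD hornerC hornerZ hornerX mulrC.
Qed.

Lemma deriv_on_line x i f :
  (on_line x (fun j => (i == j)%:R) f)^`() = on_line x (fun j => (i == j)%:R) (mderiv i f).
Proof.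
elim/mpoly_span: f => [|c f g Ef Eg|m].
- by rewrite /on_line !raddf0.
- by rewrite on_lineD on_lineZ derivD derivZ Ef Eg linearP /= on_lineD on_lineZ.
elim/mnm_ind: m => [|j m IH].
  by rewrite mpolyX0 -mpolyC1 mderivC /on_line mmapC raddf0 derivC.
rewrite mpolyXD mderivM on_lineD !on_lineM derivM IH mderivXv on_lineXv; congr (_ * _ + _).
rewrite derivD derivC derivZ derivX add0r.
by rewrite /on_line rmorph_nat scaler_nat.
Qed.

Lemma meval_mderiv_eq0 i f : (forall x, meval x f = 0) -> forall x, meval x (mderiv i f) = 0.
Proof.
move=> f0 x.
have /(congr1 (fun a : {poly C} => a^`().[0])) : on_line x (fun j => (i == j)%:R) f = 0.
  by apply: poly_eq0_of_horner => t; rewrite horner_on_line.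
rewrite deriv_on_line horner_on_line raddf0 horner0 => <-.
by apply: meval_eq => j; rewrite mul0r addr0.
Qed.

Lemma meval_mderivm_eq0 m f : (forall x, meval x f = 0) -> forall x, meval x (mderivm m f) = 0.
Proof.
elim/mnm_ind: m f => [|i m IH] f f0 x; first by rewrite mderivm0m.
by rewrite mderivmDm mderivmU1m; apply: IH => y; exact: meval_mderiv_eq0.
Qed.

Lemma meval_at0 f : meval (fun _ => 0) f = mcoeff (@mnm0 n) f.
Proof.
elim/mpoly_span: f => [|c f g Ef Eg|m]; first by rewrite meval0 mcoeff0.
  by rewrite mevalD mevalZ mcoeffD mcoeffZ Ef Eg.
rewrite mevalX mcoeffX; case: eqP => [->|m0].
  by rewrite big1 // => i _; rewrite mnm0E.
apply/eqP; rewrite prodf_seq_eq0; apply/hasP.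
have [i mi] : exists i, m i != 0%N.
  apply/existsP; apply: contra_notT m0 => /existsPn H; apply/mnmP => i.
  by rewrite mnm0E; apply/eqP; rewrite -[_ == _]negbK; exact: H.
by exists i; rewrite ?mem_index_enum //= expr0n (negbTE mi).
Qed.

(** The derivatives of a polynomial that vanishes identically vanish too, and
    their values at 0 are its coefficients up to factorials. *)
Lemma meval_eq0 f : (forall x, meval x f = 0) -> f = 0.
Proof.
move=> f0; apply/mpolyP => m; rewrite mcoeff0; apply/eqP.
have := meval_mderivm_eq0 m f0 (fun _ => 0).
rewrite meval_at0 mcoeff_mderivm addm0 -mulr_natr => /eqP.
rewrite mulf_eq0 pnatr_eq0 => /orP[//|/eqP E].
have : (0 < \prod_(i < n) (m i) ^_ (m i))%N by apply: prodn_gt0 => i; rewrite ffactnn fact_gt0.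
by rewrite E.
Qed.

Lemma meval_rho x : meval x rho = \sum_i x i ^+ 2.
Proof. by rewrite /rho raddf_sum /=; apply: eq_bigr => i _; rewrite rmorphXn /= mevalXU. Qed.

Lemma rho_neq0 : (0 < n)%N -> rho != 0.
Proof.
move=> n0; apply/eqP => /(congr1 (meval (fun _ => 1))).
rewrite meval_rho meval0; under eq_bigr do rewrite expr1n.
by rewrite sumr_const card_ord => /eqP; rewrite pnatr_eq0; case: (n) n0.
Qed.

Section OrderOfVanishing.
Context (q : mpoly n C).

(** Order of vanishing along the part of the cone where q does not vanish: F is
    divisible by rho^s once q is inverted. Clearing the denominator keeps the
    notion inside the polynomial ring. *)
Definition vanishes s F := exists e G, q ^+ e * F = rho ^+ s * G.

Lemma vanishes_exact s G : vanishes s (rho ^+ s * G).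
Proof. by exists 0%N, G; rewrite mul1r. Qed.

Lemma vanishes0 s : vanishes s 0.
Proof. by exists 0%N, 0; rewrite !mulr0. Qed.

Lemma vanishesM s h F : vanishes s F -> vanishes s (h * F).
Proof. by move=> [e [G E]]; exists e, (h * G); rewrite mulrCA E mulrCA. Qed.

Lemma vanishesD s F F' : vanishes s F -> vanishes s F' -> vanishes s (F + F').
Proof.
move=> [e [G E]] [e' [G' E']]; exists (e + e')%N, (q ^+ e' * G + q ^+ e * G').
have -> : q ^+ (e + e') * (F + F') = q ^+ e' * (q ^+ e * F) + q ^+ e * (q ^+ e' * F').
  by rewrite exprD; ring.
by rewrite E E'; ring.
Qed.

Lemma vanishesZ s (c : C) F : vanishes s F -> vanishes s (c *: F).
Proof. by rewrite -mul_mpolyC; exact: vanishesM. Qed.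

Lemma vanishesB s F F' : vanishes s F -> vanishes s F' -> vanishes s (F - F').
Proof. by move=> jF jF'; apply: vanishesD => //; rewrite -scaleN1r; exact: vanishesZ. Qed.

Lemma vanishes_saturated s e F : vanishes s (q ^+ e * F) -> vanishes s F.
Proof. by move=> [e' [G E]]; exists (e' + e)%N, G; rewrite exprD -mulrA. Qed.

Lemma vanishesS s F : vanishes s.+1 F -> vanishes s F.
Proof. by move=> [e [G E]]; exists e, (rho * G); rewrite mulrA -exprSr. Qed.

Lemma vanishes_mulrho s t F : vanishes t F -> vanishes (s + t) (rho ^+ s * F).
Proof. by move=> [e [G E]]; exists e, G; rewrite mulrCA E mulrA -exprD. Qed.

Lemma vanishes_cancelrho s t F : (0 < n)%N -> vanishes (s + t) (rho ^+ s * F) -> vanishes t F.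
Proof.
move=> n0 [e [G E]]; exists e, G.
have : rho ^+ s != 0 by rewrite expf_neq0 // rho_neq0.
by move/mulfI; apply; rewrite mulrCA E exprD mulrA.
Qed.

Lemma mderivXn i f k : mderiv i (f ^+ k.+1) = (f ^+ k * mderiv i f) *+ k.+1.
Proof.
elim: k => [|k IH]; first by rewrite mul1r.
rewrite exprS mderivM IH mulrnAr mulrA -exprS mulrC -[in LHS](mulr1n (_ ^+ _ * _)).
by rewrite -mulrnDr add1n.
Qed.

Lemma vanishes_mderiv i s F : vanishes s.+1 F -> vanishes s (mderiv i F).
Proof.
move=> [e [G E]]; apply: (@vanishes_saturated _ e.+1).
have jF : vanishes s F by apply: vanishesS; exists e, G.
have -> : q ^+ e.+1 * mderiv i F = mderiv i (q ^+ e.+1 * F) - mderiv i (q ^+ e.+1) * F.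
  by rewrite mderivM addrAC subrr add0r.
apply: vanishesB; last exact: vanishesM.
rewrite exprS -mulrA E mulrCA mderivM mderivXn -mulr_natr; apply: vanishesD.
  rewrite -!mulrA; exact: vanishes_exact.
by rewrite exprSr -mulrA; exact: vanishes_exact.
Qed.

(** In the expansion in powers of rho near the cone, F starts with
    q^(- e) G rho^s. *)
Definition symbol s e G F := vanishes s.+1 (q ^+ e * F - rho ^+ s * G).

Lemma symbol_exact s e G F : q ^+ e * F = rho ^+ s * G -> symbol s e G F.
Proof. by rewrite /symbol => ->; rewrite subrr; exact: vanishes0. Qed.

Lemma symbolD s e (c : C) G G' F F' : symbol s e G F -> symbol s e G' F' ->
  symbol s e (c *: G + G') (c *: F + F').
Proof.
move=> H H'; rewrite /symbol !mulrDr -!scalerAr opprD addrACA -scalerBr.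
by apply: vanishesD => //; exact: vanishesZ.
Qed.

(** Only the derivative of the power of rho lowers the order, and the gradient
    of rho is 2x. *)
Lemma symbol_mderiv i s e G F : symbol s.+1 e G F ->
  symbol s e ((Xv i * G) *+ (2 * s.+1)) (mderiv i F).
Proof.
move=> H; have jF : vanishes s.+1 F.
  apply: (@vanishes_saturated _ e); rewrite -[_ * F](subrK (rho ^+ s.+1 * G)).
  by apply: vanishesD; [exact: vanishesS|exact: vanishes_exact].
have := vanishes_mderiv i H; rewrite /symbol linearB /= !mderivM mderivXn mderiv_rho.
set A := mderiv i _ * F; set B := _ * mderiv i G => jH.
have -> : q ^+ e * mderiv i F - rho ^+ s * (Xv i * G *+ (2 * s.+1)) =
   A + q ^+ e * mderiv i F - ((rho ^+ s * (Xv i *+ 2)) *+ s.+1 * G + B) - A + B.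
  rewrite !mulrnAr !mulrnAl -mulrnA mulrA; move: (_ *+ _) (_ * mderiv i F) => a b; ring.
apply: vanishesD; last exact: vanishes_exact.
by apply: vanishesB => //; exact: vanishesM.
Qed.

Lemma symbol_mderivm m s e G F : symbol (s + mdeg m) e G F ->
  symbol s e ((Xm m * G) *+ (2 ^ mdeg m * (s + mdeg m) ^_ (mdeg m))) (mderivm m F).
Proof.
elim/mnm_ind: m s G F => [|i m IH] s G F.
  by rewrite mdeg0 addn0 mpolyX0 mul1r ffactn0 mderivm0m.
rewrite mdegD mdeg1 add1n addnS => /(symbol_mderiv i)/IH.
rewrite mderivmDm mderivmU1m mpolyXD -!mulrnAr -mulrnA.
have -> : (2 * (s + mdeg m).+1 * (2 ^ mdeg m * (s + mdeg m) ^_ mdeg m) =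
  2 ^ (mdeg m).+1 * (s + mdeg m).+1 ^_ (mdeg m).+1)%N.
  by rewrite ffactSS expnS mulnACA.
by rewrite mulrA [Xm m * _]mulrC.
Qed.

(** By [symbol_mderiv] the operator p(D) acts on leading coefficients as
    multiplication by p, up to a positive integer. *)
Lemma symbol_diffop b s e p G F : p \is hom b -> symbol (s + b) e G F ->
  symbol s e ((p * G) *+ (2 ^ b * (s + b) ^_ b)) (diffop p F).
Proof.
move=> pb H; rewrite /diffop {1}(mpolyE p) mulr_suml -sumrMnl.
rewrite big_seq [X in symbol _ _ _ X]big_seq.
elim/big_rec2 : _ => [|m y z mp IH]; first by apply: symbol_exact; rewrite !mulr0.
rewrite -scalerAl scalerMnr; apply: symbolD => //.
have mb : mdeg m = b by apply: (hom_coef pb); rewrite -mcoeff_msupp.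
by rewrite -mb; apply: symbol_mderivm; rewrite mb.
Qed.

(** The leading coefficient of q(D) F is that of F times q, up to a positive
    integer. If q(D) F = 0, it has to vanish on the cone where q does not: the cone
    is noncharacteristic there. *)
Lemma vanishes_step b s F : (0 < n)%N -> q \is hom b -> diffop q F = 0 ->
  vanishes (s + b) F -> vanishes (s + b).+1 F.
Proof.
move=> n0 qb qF [e [G E]].
have := symbol_diffop qb (symbol_exact E); rewrite qF /symbol mulr0 sub0r.
set K := (2 ^ b * _)%N; have K0 : (K%:R : C) != 0.
  by rewrite pnatr_eq0 -lt0n muln_gt0 expn_gt0 ffact_gt0 leq_addl.
move=> /(vanishesZ (- 1)); rewrite scaleN1r opprK -addn1 => /(vanishes_cancelrho n0).
move=> /(vanishesZ (K%:R^-1)); rewrite -[q * G *+ K]scaler_nat scalerA mulVf // scale1r => jG.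
have {}jG : vanishes 1 G by apply: (@vanishes_saturated _ 1); rewrite expr1.
apply: (@vanishes_saturated _ e); rewrite E -addn1; exact: vanishes_mulrho.
Qed.

(** On every line through v, the order of vanishing of F at v is infinite. *)
Lemma vanishes_all_orders_eq0 v F : meval v rho = 0 -> meval v q != 0 ->
  (forall s, vanishes s F) -> F = 0.
Proof.
move=> rv qv jF; apply: meval_eq0 => x.
pose y i := x i - v i; pose a := on_line v y F.
have on0 f : (on_line v y f).[0] = meval v f.
  by rewrite horner_on_line; apply: meval_eq => i; rewrite mul0r addr0.
suff /(congr1 (fun b : {poly C} => b.[1])) : a = 0.
  rewrite horner0 horner_on_line => <-; apply: meval_eq => i.
  by rewrite mul1r addrC subrK.
have [e [G /(congr1 (on_line v y))]] := jF (size a).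
rewrite !on_lineM !on_lineXn -/a => E.
have /factor_theorem[z Ez] : root (on_line v y rho) 0 by rewrite /root on0 rv.
have : 'X ^+ size a %| on_line v y q ^+ e * a.
  by rewrite E Ez polyC0 subr0 exprMn dvdp_mulr // dvdp_mull.
rewrite Gauss_dvdpr; last first.
  apply/coprimep_expl/coprimep_expr; rewrite -['X]subr0 -polyC0 coprimep_sym.
  by rewrite coprimep_XsubC /root on0.
apply: contraTeq => a0; apply/negP => /(dvdp_leq a0).
by rewrite size_polyXn ltnn.
Qed.

End OrderOfVanishing.

(** Divisibility by rho^b means zero Cauchy data on the cone for the equation
    q(D) F = 0 of order b; the cone being noncharacteristic at v, the order of
    vanishing of F there grows indefinitely. *)
Lemma diffop_rho_uniqueness b q v F : (0 < n)%N -> q \is hom b ->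
  meval v rho = 0 -> meval v q != 0 ->
  (exists G, F = rho ^+ b * G) -> diffop q F = 0 -> F = 0.
Proof.
move=> n0 qb rv qv [G EF] qF; apply: (vanishes_all_orders_eq0 rv qv) => s.
suff H : vanishes q (s + b) F.
  by elim: b H {qb EF} => [|b IH]; rewrite ?addn0 // addnS => /vanishesS/IH.
elim: s => [|s IH]; first by rewrite EF add0n; exact: vanishes_exact.
by rewrite addSn; exact: vanishes_step.
Qed.

Section Nullstellensatz.
Context (i0 i1 : 'I_n) (i01 : i1 != i0).

Definition indep f := forall x y, (forall i, i != i0 -> x i = y i) -> meval x f = meval y f.

Definition rho' := \sum_(i | i != i0) Xv i ^+ 2.

Lemma rhoE : rho = Xv i0 ^+ 2 + rho'.
Proof. by rewrite /rho (bigD1 i0). Qed.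

Lemma meval_rho' x : meval x rho' = \sum_(i | i != i0) x i ^+ 2.
Proof. by rewrite raddf_sum /=; apply: eq_bigr => i _; rewrite rmorphXn /= mevalXU. Qed.

Lemma indep_rho' : indep rho'.
Proof. by move=> x y xy; rewrite !meval_rho'; apply: eq_bigr => i /xy ->. Qed.

Lemma indepM f g : indep f -> indep g -> indep (f * g).
Proof. by move=> hf hg x y xy; rewrite !mevalM (hf x y) // (hg x y). Qed.

Lemma indepD (c : C) f g : indep f -> indep g -> indep (c *: f + g).
Proof. by move=> hf hg x y xy; rewrite !mevalD !mevalZ (hf x y) // (hg x y). Qed.

(** Euclidean division by rho, monic of degree two in the variable of index i0. *)
Lemma rho_division f : exists g a b,
  [/\ indep a, indep b & f = rho * g + a + b * Xv i0].
Proof.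
have i0c (c : C) : indep (mpolyC n c) by move=> x y _; rewrite !mevalC.
have ind0 : indep 0 by move=> x y _; rewrite !meval0.
elim/mpoly_span: f => [|c f f' [g [a [b [ha hb ->]]]] [g' [a' [b' [ha' hb' ->]]]]|m].
- by exists 0, 0, 0; rewrite mulr0 mul0r !addr0.
- exists (c *: g + g'), (c *: a + a'), (c *: b + b'); split; try exact: indepD.
  rewrite -!mul_mpolyC; ring.
elim/mnm_ind: m => [|i m [g [a [b [ha hb E]]]]].
  exists 0, 1, 0; rewrite mulr0 mul0r add0r addr0 mpolyX0; split => //.
  by rewrite -mpolyC1.
rewrite mpolyXD E; have [->|ii] := eqVneq i i0.
  exists (Xv i0 * g + b), ((- 1) *: (b * rho') + 0), a; split => //.
    by apply: indepD => //; apply: indepM => //; exact: indep_rho'.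
  rewrite rhoE scaleN1r; ring.
have hi : indep (Xv i) by move=> x y xy; rewrite !mevalXU xy.
exists (Xv i * g), (Xv i * a), (Xv i * b); split; try by apply: indepM.
ring.
Qed.

(** Over each value of the other coordinates with rho' <> 0, the cone has two
    points, whose coordinates of index i0 are opposite and nonzero; the remainder
    of f, affine in that coordinate, vanishes at both, hence is 0. *)
Lemma nullstellensatz f : (forall v, meval v rho = 0 -> meval v f = 0) ->
  exists g, f = rho * g.
Proof.
move=> fv; have [g [a [b [ha hb E]]]] := rho_division f; exists g.
have H x : meval x a = 0 /\ meval x b * meval x rho' = 0.
  pose r := sqrtC (- meval x rho').
  pose pt (z : C) i := if i == i0 then z else x i.
  have ptx z i : i != i0 -> pt z i = x i by rewrite /pt => /negbTE ->.
  have root_pt z : z ^+ 2 = - meval x rho' -> meval x a + meval x b * z = 0.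
    move=> zr; have rz : meval (pt z) rho = 0.
      rewrite rhoE mevalD rmorphXn /= mevalXU /pt eqxx zr.
      by rewrite (indep_rho' (ptx z)) addNr.
    have := fv _ rz; rewrite E !mevalD !mevalM rz mul0r add0r mevalXU.
    by rewrite (ha _ _ (ptx z)) (hb _ _ (ptx z)) /pt eqxx.
  have r1 := root_pt r (sqrtCK _).
  have r2 := root_pt (- r) (etrans (sqrrN r) (sqrtCK _)).
  have a0 : meval x a = 0.
    have : meval x a *+ 2 = 0.
      rewrite -[RHS](addr0 0) -{1}r1 -r2; ring.
    by move/eqP; rewrite mulrn_eq0 => /eqP.
  split => //; rewrite a0 add0r in r1.
  by rewrite -[meval x rho']opprK -(sqrtCK (- meval x rho')) -/r expr2 mulrN mulrA r1 mul0r oppr0.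
have a0 : a = 0 by apply: meval_eq0 => x; case: (H x).
have /eqP : b * rho' = 0 by apply: meval_eq0 => x; rewrite mevalM; case: (H x).
rewrite mulf_eq0 => /orP[/eqP b0|/eqP r0]; first by rewrite E a0 b0 mul0r !addr0.
have := meval_rho' (fun i => (i == i1)%:R); rewrite r0 meval0 (bigD1 i1) //=.
rewrite big1 => [|i /andP[_ /negbTE ->]]; last by rewrite expr0n.
by rewrite eqxx expr1n addr0 => /esym/eqP; rewrite oner_eq0.
Qed.

End Nullstellensatz.

(** * Spanning by multiples of P and polyharmonic polynomials *)

Definition linear_form v : mpoly n C := \sum_i v i *: Xv i.

Lemma mderiv_linear_form v i : mderiv i (linear_form v) = mpolyC n (v i).
Proof.
rewrite /linear_form raddf_sum (bigD1 i) //= big1 => [|k ki].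
  by rewrite mderivZ mderivXv eqxx addr0 -mul_mpolyC mulr1.
by rewrite mderivZ mderivXv eq_sym (negbTE ki) scaler0.
Qed.

Lemma hom_linear_form v b : linear_form v ^+ b \is hom b.
Proof.
rewrite -[b in hom b]mul1n; apply: dhomogMn.
by apply: rpred_sum => i _; apply: rpredZ; exact: hom_Xv.
Qed.

Definition deriv_along v f := \sum_i v i *: mderiv i f.

(** The derivative along v of the linear form of v is the value of rho at v. *)
Lemma deriv_along_linear_formX v k : meval v rho = 0 -> deriv_along v (linear_form v ^+ k) = 0.
Proof.
move=> rv; case: k => [|k]; rewrite /deriv_along.
  by rewrite big1 // => i _; rewrite expr0 -mpolyC1 mderivC scaler0.
under eq_bigr do rewrite mderivXn mderiv_linear_form mulrC mul_mpolyC -scalerMnr scalerA -expr2.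
by rewrite sumrMnl -scaler_suml -meval_rho rv scale0r mul0rn.
Qed.

(** The gradient of a power of the linear form of v is a multiple of v, so its
    divergence is a derivative along v. *)
Lemma harmonic_linear_formX v k : meval v rho = 0 -> lap (linear_form v ^+ k) = 0.
Proof.
move=> rv; case: k => [|k]; rewrite /laplacian.
  by rewrite big1 // => i _; rewrite expr0 -mpolyC1 mderivC mderiv0.
under eq_bigr do rewrite mderivXn mderiv_linear_form mulrC mul_mpolyC raddfMn /= mderivZ.
by rewrite sumrMnl -/(deriv_along _ _) deriv_along_linear_formX // mul0rn.
Qed.

Lemma laplacian_mul_linear_formX v k f : meval v rho = 0 ->
  lap (f * linear_form v ^+ k.+1) = lap f * linear_form v ^+ k.+1 +
    (deriv_along v f * linear_form v ^+ k) *+ (2 * k.+1).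
Proof.
move=> rv; rewrite laplacianM (harmonic_linear_formX _ rv) mulr0 addr0; congr (_ + _).
under eq_bigr do rewrite mderivXn mderiv_linear_form mulrnAr mulrCA mulrC -mulrA mulrCA mul_mpolyC.
rewrite sumrMnl mulnC mulrnA /deriv_along mulr_suml; congr (_ *+ _ *+ _).
by apply: eq_bigr => i _; rewrite -!scalerAl mulrC.
Qed.

Lemma meval_deriv_along v d f : f \is hom d -> meval v (deriv_along v f) = meval v f *+ d.
Proof.
move=> fd; rewrite -mevalMn -(euler fd) /deriv_along !raddf_sum /=; apply: eq_bigr => i _.
by rewrite mevalZ mevalM mevalXU.
Qed.

Lemma hom_deriv_along v d f : f \is hom d -> deriv_along v f \is hom d.-1.
Proof. by move=> fd; apply: rpred_sum => i _; apply/rpredZ/hom_mderiv. Qed.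

Lemma hom0_const f : f \is hom 0 -> f = mpolyC n (mcoeff (@mnm0 n) f).
Proof.
move=> f0; apply/mpolyP => m; rewrite mcoeffC.
case: eqP => [->|m0]; rewrite ?mulr1 // mulr0.
apply/eqP; apply: contra_notT m0 => /(hom_coef f0) /eqP.
by rewrite mdeg_eq0 eq_sym => /eqP.
Qed.

(** Each Laplacian has to trade a factor of the linear form for a derivative of f
    along v, because spending a Laplacian on f alone uses up its degree too fast.
    What remains is a multiple of the b-th derivative of f along v, which is b! f(v). *)
Lemma iter_laplacian_mul_linear_form v b f : meval v rho = 0 -> f \is hom b ->
  exists K, iter b lap (f * linear_form v ^+ b) = mpolyC n (meval v f *+ K.+1).
Proof.
move=> rv; elim: b f => [|b IH] f fb.
  by exists 0%N; rewrite mulr1 (hom0_const fb) mevalC.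
have [K EK] := IH _ (hom_deriv_along v fb).
have [K' EK'] : exists K', (b.+1 * (K.+1 * (2 * b.+1)))%N = K'.+1.
  by exists (b.+1 * (K.+1 * (2 * b.+1))).-1; rewrite prednK // !muln_gt0.
exists K'; rewrite iterSr laplacian_mul_linear_formX // iter_laplacianD iter_laplacianMn EK.
have -> : iter b lap (lap f * linear_form v ^+ b.+1) = 0.
  case: b fb {IH K EK K' EK'} => [|b] fb.
    have /= -> := iter_laplacian_hom_eq0 (s := 1) fb isT; exact: mul0r.
  apply: iter_laplacian_mul_harmonic; last exact: harmonic_linear_formX.
  move=> m bm; apply/eqP; apply: contraTT bm => /(hom_coef (hom_laplacian fb)) ->.
  by rewrite subSS subn1 -ltnNge.
by rewrite add0r (meval_deriv_along v fb) -raddfMn /= -!mulrnA EK'.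
Qed.

(** Replaces the Nullstellensatz for one variable x, where the ideal of
    rho = x^2 is not radical. *)
Lemma hom_one_variable b q (i0 : 'I_n) : (forall i, i = i0) -> q \is hom b ->
  (~ exists g, q = rho * g) -> (b < 2)%N.
Proof.
move=> all0 qb nq; rewrite ltnNge; apply/negP => b2; apply: nq.
have rE : rho = Xv i0 ^+ 2.
  by rewrite /rho (bigD1 i0) //= big1 ?addr0 // => i; rewrite (all0 i) eqxx.
exists (\sum_(m <- msupp q) mcoeff m q *: Xm (mnm_sub m (mnm_muln (mnm1 i0) 2))).
rewrite {1}(mpolyE q) mulr_sumr big_seq [RHS]big_seq; apply: eq_bigr => m mq.
rewrite -scalerAr rE mpolyXn -mpolyXD addmC submK //.
apply/mnm_lepP => i; rewrite mulmnE mnm1E (all0 i) eqxx mul1n.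
have <- : mdeg m = m i0; last first.
  by rewrite (hom_coef qb) // -mcoeff_msupp.
by rewrite mdegE (bigD1 i0) //= big1 ?addn0 // => k; rewrite (all0 k) eqxx.
Qed.

(** The first conclusion bounds the maximal polyharmonic degree from below, the
    second says that this bound is enough for uniqueness. Both come from a point
    of the cone where q does not vanish, except when q = c x in one variable,
    which is done by hand. *)
Lemma not_rho_multiple b q : (0 < n)%N -> q \is hom b -> (~ exists g, q = rho * g) ->
  (exists h, [/\ h \is hom b, Defs.harmonic h & iter b lap (q * h) != 0]) /\
  (forall F, (exists G, F = rho ^+ b * G) -> (forall f, fischer F (q * f) = 0) -> F = 0).
Proof.
move=> n0 qb nq.
have cone v : meval v rho = 0 -> meval v q != 0 ->
  (exists h, [/\ h \is hom b, Defs.harmonic h & iter b lap (q * h) != 0]) /\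
  (forall F, (exists G, F = rho ^+ b * G) -> (forall f, fischer F (q * f) = 0) -> F = 0).
  move=> rv qv; split.
    exists (linear_form v ^+ b); split; first exact: hom_linear_form.
      exact: harmonic_linear_formX.
    have [K ->] := iter_laplacian_mul_linear_form rv qb.
    by rewrite mpolyC_eq0 mulrn_eq0.
  move=> F FG Fq; apply: (diffop_rho_uniqueness n0 qb rv qv FG).
  apply: fischer_nondeg => m; rewrite -fischer_mul; exact: Fq.
have i0 : 'I_n := Ordinal n0.
have [[i1 i10]|all0] := pselect (exists i, i != i0).
  suff [v [rv qv]] : exists v, meval v rho = 0 /\ meval v q != 0 by exact: (cone v).
  apply: contrapT => H; apply: nq; apply: (nullstellensatz i10) => v rv.
  by apply/eqP/negPn/negP => qv; apply: H; exists v.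
have {}all0 i : i = i0 by apply/eqP/negPn/negP => ii; apply: all0; exists i.
have rE : rho = Xv i0 ^+ 2.
  by rewrite /rho (bigD1 i0) //= big1 ?addr0 // => i; rewrite (all0 i) eqxx.
have q0 : q != 0 by apply/eqP => q0; apply: nq; exists 0; rewrite mulr0.
have := hom_one_variable all0 qb nq.
case: b qb cone => [|[|//]] qb cone _.
  apply: (cone (fun _ => 0)); rewrite meval_at0.
    by rewrite -meval_at0 meval_rho big1 // => i _; rewrite expr0n.
  by apply: contra q0 => /eqP E; rewrite (hom0_const qb) E mpolyC0.
have [c qE] : exists c, q = c *: Xv i0.
  exists (mcoeff (mnm1 i0) q); apply/mpolyP => m; rewrite mcoeffZ mcoeffX.
  have [<-|mi] := eqVneq (mnm1 i0) m; first by rewrite mulr1.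
  rewrite mulr0; apply/eqP; apply: contraNT mi => /(hom_coef qb) m1.
  apply/eqP/mnmP => i; rewrite (all0 i) mnm1E eqxx -[LHS]/1%N -m1.
  by rewrite mdegE (bigD1 i0) //= big1 ?addn0 // => k; rewrite (all0 k) eqxx.
have c0 : c != 0 by apply: contra q0 => /eqP c0; rewrite qE c0 scale0r.
split.
  exists (Xv i0); split; first exact: hom_Xv.
    exact: (iter_laplacian_hom_eq0 (s := 1) (hom_Xv i0)).
  rewrite qE -scalerAl [iter 1 _ _]/= linearZ /= -expr2 -rE laplacian_rho scaler_eq0 negb_or c0.
  by rewrite -mpolyC_nat mpolyC_eq0 pnatr_eq0 muln_eq0 -lt0n.
move=> F [G FG] Fq; apply: fischer_nondeg => m.
have [->|m0] := eqVneq m (@mnm0 n).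
  rewrite fischerX -meval_at0 FG expr1 mevalM meval_rho big1 ?mul0r // => i _.
  by rewrite expr0n.
have mi : m i0 != 0%N.
  by apply: contra m0 => /eqP mi; apply/eqP/mnmP => i; rewrite (all0 i) mnm0E.
have := Fq (Xm (mnm_sub m (mnm1 i0))).
rewrite qE -scalerAl linearZ /= -mpolyXD addmC submK ?lep1mP // => /eqP.
by rewrite mulf_eq0 (negbTE c0) => /eqP.
Qed.

(** Factors of rho are split off one by one; Fischer duality provides homogeneous
    cofactors. *)
Lemma rho_factor d f : (0 < n)%N -> f \is hom d -> f != 0 -> exists j b q,
  [/\ d = (2 * j + b)%N, q \is hom b, f = rho ^+ j * q & ~ exists g, q = rho * g].
Proof.
move=> n0; have [k] := ubnP d; elim: k d f => // k IH d f dk fd f0.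
have [[g fg]|nf] := pselect (exists g, f = rho * g); last first.
  by exists 0%N, d, f; rewrite mul1r.
have [|G Gd fG] := @fischer_orthogonal_polyharmonic 1 _ _ n0 fd.
  by move=> u _ /= u0; rewrite fischerC fg fischer_mulrho u0 fischerC linear0.
rewrite muln1 expr1 in Gd fG.
have G0 : G != 0 by apply: contra f0 => /eqP G0; rewrite fG G0 mulr0.
have dE : d = (2 + (d - 2))%N.
  by apply: (dhomog_uniq f0 fd); rewrite fG; apply: homM => //; exact: hom_rho.
have [|j [b [q [E qb GE nq]]]] := IH _ _ _ Gd G0.
  by rewrite -ltnS (leq_trans _ dk) // ltnS {2}dE addnC addn2.
exists j.+1, b, q; split => //; first by rewrite dE E mulnS addnA.
by rewrite fG GE mulrA -exprS.
Qed.

Lemma top_component P : P != 0 -> exists k,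
  pihomog mdeg k P != 0 /\ P = \sum_(d < k.+1) pihomog mdeg d P.
Proof.
move=> P0; have := @pihomog_partitionE _ _ mdeg _ P (leqnn _).
elim: (mmeasure mdeg P) => [|k IH] E; first by rewrite E big_ord0 eqxx in P0.
have [z|nz] := eqVneq (pihomog mdeg k P) 0; last by exists k.
by apply: IH; rewrite {1}E big_ord_recr /= z addr0.
Qed.

Lemma max_product_degree_ge P k h : Defs.harmonic h -> iter k lap (P * h) != 0 ->
  (k <= max_product_degree P)%N.
Proof.
move=> hh Ph; have [ub _] := max_product_degreeP P.
have /ub : harmonic_product_degrees P (polyharmonic_degree (P * h)) by exists h.
rewrite leEnat; apply: leq_trans; rewrite leqNgt; apply: contra Ph => dk.
rewrite /polyharmonic_degree in dk; move: dk; case: ex_minnP => N /eqP PN _ Nk.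
by rewrite (iter_laplacian_leq Nk).
Qed.

Lemma laplacian_rho_multiple s G : (0 < n)%N -> exists G', lap (rho ^+ s.+1 * G) = rho ^+ s * G'.
Proof.
move=> n0; have h1 : (1 : mpoly n C) \is hom 0 by exact: dhomog1.
have [c] := laplacian_rhoX s n0 h1; rewrite !mulr1 -mpolyC1.
have -> : lap (mpolyC n 1) = 0 by apply: big1 => i _; rewrite mderivC mderiv0.
rewrite mulr0 add0r => E; rewrite laplacianM E.
exists (G *+ c.+1 + (\sum_i (mderiv i rho *+ s.+1) * mderiv i G) *+ 2 + rho * lap G).
rewrite !mulrDr mulrA -exprSr mulrnAl !mulrnAr -mulr2n.
congr (_ + _ *+ 2 + _); rewrite mulr_sumr.
by apply: eq_bigr => i _; rewrite mderivXn mulrA mulrnAr.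
Qed.

Lemma iter_laplacian_rho_multiple j s G : (0 < n)%N ->
  exists G', iter j lap (rho ^+ (j + s) * G) = rho ^+ s * G'.
Proof.
move=> n0; elim: j G => [|j IH] G; first by exists G.
have [G1 E1] := laplacian_rho_multiple (j + s) G n0.
by have [G' E'] := IH G1; exists G'; rewrite iterSr addSn E1.
Qed.

Section Functional.
Context (ell : mpoly n C -> C).
Context (ellP : forall (c : C) f g, ell (c *: f + g) = c * ell f + ell g).

Lemma ell0 : ell 0 = 0.
Proof. by have := ellP (- 1) 0 0; rewrite scaler0 addr0 mulN1r addNr. Qed.

Lemma ell_sum (I : Type) (r : seq I) (a : I -> C) (f : I -> mpoly n C) :
  ell (\sum_(k <- r) a k *: f k) = \sum_(k <- r) a k * ell (f k).
Proof. by elim: r => [|k r IH]; rewrite ?big_nil ?ell0 // !big_cons ellP IH. Qed.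

Lemma ell_hom_eq0 d f : f \is hom d -> (forall m, mdeg m = d -> ell (Xm m) = 0) -> ell f = 0.
Proof.
move=> fd H; rewrite (mpolyE f) ell_sum big_seq big1 // => m mf.
by rewrite H ?mulr0 // (hom_coef fd) // -mcoeff_msupp.
Qed.

(** The homogeneous component of degree d of the exponential generating
    function of the moments of ell; it represents ell on homogeneous polynomials
    of degree d through the Fischer pairing. *)
Definition moment_poly d : mpoly n C :=
  \sum_(m : bmultinom n d.+1) (if mdeg m == d then ell (Xm m) / (mfact m)%:R else 0) *: Xm m.

Lemma mcoeff_moment_poly d m : mcoeff m (moment_poly d) =
  if mdeg m == d then ell (Xm m) / (mfact m)%:R else 0.
Proof.
have [md|md] := ltnP (mdeg m) d.+1.
  pose c m' := if mdeg m' == d then ell (Xm m') / (mfact m')%:R else 0.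
  by rewrite /moment_poly (mcoeff_mpoly c).
rewrite gtn_eqF // /moment_poly raddf_sum big1 //= => m' _.
rewrite mcoeffZ mcoeffX; have [E|_] := eqVneq (m' : multinom n) m; last by rewrite mulr0.
by move: md; rewrite -E leqNgt bmdeg.
Qed.

Lemma hom_moment_poly d : moment_poly d \is hom d.
Proof. by apply: homI => m; rewrite mcoeff_moment_poly; case: ifP => [/eqP //|_]; rewrite eqxx. Qed.

Lemma fischer_moment_poly d f : f \is hom d -> fischer (moment_poly d) f = ell f.
Proof.
move=> fd; rewrite [in RHS](mpolyE f) ell_sum /fischer big_seq [RHS]big_seq.
apply: eq_bigr => m mf; rewrite mcoeff_moment_poly.
rewrite (hom_coef fd) ?eqxx -?mcoeff_msupp // divfK //.
by rewrite pnatr_eq0 -lt0n; apply: prodn_gt0 => i; exact: fact_gt0.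
Qed.

(** Dual form of a Fischer decomposition f = P g + u with Lap^N u = 0, N being the
    maximal polyharmonic degree of P times a harmonic polynomial. A nonzero moment
    polynomial of least degree would be divisible by rho^N and annihilated by the
    differential operator of the leading form rho^j q of P; Lap^j turns it into a
    multiple of rho^b annihilated by q(D), which is 0. *)
Theorem fischer_functional_eq0 P : P != 0 ->
  (forall f, ell (P * f) = 0) ->
  (forall h, polyharmonic_space (max_product_degree P) h -> ell h = 0) ->
  forall f, ell f = 0.
Proof.
move=> P0 ellPf ellU.
have [n0|n0] := posnP n.
  move=> f; have nil0 m : m = @mnm0 n by apply/mnmP => -[i ilt]; exfalso; rewrite n0 in ilt.
  have PE : P = mpolyC n (mcoeff (@mnm0 n) P).
    by apply/mpolyP => m; rewrite (nil0 m) mcoeffC eqxx mulr1.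
  rewrite -[f]mul1r -mpolyC1 -(mulVf (_ : mcoeff (@mnm0 n) P != 0)); last first.
    by apply: contra P0 => /eqP P00; rewrite PE P00 mpolyC0.
  by rewrite mpolyCM -PE mulrAC mulrC ellPf.
have [m [p0 PE]] := top_component P0; set p := pihomog mdeg m P in p0.
have pm : p \is hom m by exact: pihomogP.
have [j [b [q [mE qb pE nq]]]] := rho_factor n0 pm p0.
have [[h [hb hh qh]] uniq] := not_rho_multiple n0 qb nq.
(* The lower components of P times h have degree less than 2 (b + j). *)
have jbN : (b + j <= max_product_degree P)%N.
  apply: (max_product_degree_ge hh); rewrite PE big_ord_recr /= -/p mulrDl iter_laplacianD.
  rewrite mulr_suml [X in X + _](_ : _ = 0) ?add0r; last first.
    elim/big_rec: _ => [|d f _ IH]; first exact: iter_laplacian0.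
    rewrite iter_laplacianD IH addr0; apply: (@iter_laplacian_hom_eq0 (d + b)).
      by apply: homM => //; exact: pihomogP.
    have dm : (d < 2 * j + b)%N by rewrite -mE.
    by rewrite mulnDr [(2 * b)%N]mul2n -addnn addnAC ltn_add2r addnC.
  rewrite pE -mulrA; have qhb := homM qb hb.
  have [|//] := @iter_laplacian_rhoX b j _ _ n0 qhb qh.
  apply: (iter_laplacian_hom_eq0 qhb).
  by rewrite mul2n -addnn addnS addSn ltnS leqnSn.
have key d : (forall m, (mdeg m < d)%N -> ell (Xm m) = 0) -> moment_poly d = 0.
  move=> IH; set F := moment_poly d; have Fd : F \is hom d by exact: hom_moment_poly.
  (* By minimality of d, the components of P below the leading form p contribute
     nothing in degree d. *)
  have Fp f : fischer F (p * f) = 0.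
    elim/mpoly_span: f => [|c f g Ef Eg|mu]; first by rewrite mulr0 linear0.
      by rewrite mulrDr -scalerAr linearP /= Ef Eg mulr0 addr0.
    have mumu : Xm mu \is hom (mdeg mu) by rewrite dhomogX.
    have pmu := homM pm mumu.
    have [md|] := eqVneq (m + mdeg mu)%N d; last exact: fischer_hom_neq pmu Fd.
    rewrite fischer_moment_poly -?md //.
    have := ellPf (Xm mu); rewrite {1}PE big_ord_recr /= -/p mulrDl mulr_suml.
    rewrite -[X in ell (X + _)]scale1r ellP mul1r.
    suff -> : ell (\sum_(i < m) pihomog mdeg i P * Xm mu) = 0 by rewrite add0r.
    under eq_bigr do rewrite -[_ * _]scale1r.
    rewrite ell_sum big1 // => d' _; rewrite mul1r.
    apply: (ell_hom_eq0 (homM (pihomogP mdeg _ _) mumu)) => m' m'd; apply: IH.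
    by rewrite m'd -md ltn_add2r.
  have [|G Gd FG] := @fischer_orthogonal_polyharmonic (j + b) _ _ n0 Fd.
    move=> u ud uk; rewrite fischer_moment_poly // ellU //.
    by apply: (iter_laplacian_leq jbN); rewrite addnC.
  have F1 : iter j lap F = 0.
    apply: uniq; first by rewrite FG; exact: iter_laplacian_rho_multiple.
    by move=> f; rewrite -fischer_mulrhoX mulrA -pE.
  (* F is rho^j times a homogeneous polynomial, on which Lap^j is injective. *)
  apply/eqP/negPn/negP => F0; pose g := rho ^+ b * G.
  have FE : F = rho ^+ j * g by rewrite FG exprD mulrA.
  have g0 : g != 0 by apply: contra F0 => /eqP g0; rewrite FE g0 mulr0.
  have gd : g \is hom (2 * b + (d - 2 * (j + b))).
    by apply: homM => //; apply: dhomogMn; exact: hom_rho.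
  have [t [t1 t2]] := laplacian_nilpotent g0.
  have [] := iter_laplacian_rhoX j n0 gd t1 t2.
  by rewrite -FE iterD F1 iter_laplacian0 eqxx.
have ellX m' : ell (Xm m') = 0.
  have [d] := ubnP (mdeg m'); elim: d m' => // d IH m'; rewrite ltnS leq_eqVlt.
  case/orP => [/eqP md|]; last exact: IH.
  rewrite -(@fischer_moment_poly d); last by rewrite dhomogX /= md.
  by rewrite key // fischerC linear0.
by move=> f; rewrite (mpolyE f) ell_sum big1 // => m' _; rewrite ellX mulr0.
Qed.

End Functional.
End Algebra.

(** * Polynomial step functions *)

Section StepFunctions.
Context {R : realType}.

Lemma bernoulli_sub (a : R) N : 0 <= a <= 1 -> 1 - N%:R * a <= (1 - a) ^+ N.
Proof.
move=> /andP[a0 a1]; elim: N => [|N IH]; first by rewrite mul0r subr0.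
rewrite exprS; apply: (le_trans _ (ler_wpM2l _ IH)); last by rewrite subr_ge0.
have : 0 <= N%:R * a * a by rewrite !mulr_ge0.
rewrite -natr1; nra.
Qed.

Lemma bernoulli_inv (a : R) N : 0 <= a <= 1 -> (1 - a) ^+ N <= (1 + N%:R * a)^-1.
Proof.
move=> /andP[a0 a1]; have Na0 : 0 <= N%:R * a by rewrite mulr_ge0.
rewrite -[leRHS]mul1r ler_pdivlMr; last by rewrite ltr_wpDr.
have : (1 - a) ^+ N * (1 + a) ^+ N <= 1.
  rewrite -exprMn exprn_ile1 //; nra.
apply: le_trans; apply: ler_wpM2l; first by rewrite exprn_ge0 // subr_ge0.
elim: N {Na0} => [|N IH]; first by rewrite mul0r addr0.
rewrite exprSr; apply: (le_trans _ (ler_wpM2r _ IH)); last by rewrite addr_ge0.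
have : 0 <= N%:R * a * a by rewrite !mulr_ge0.
rewrite -natr1; nra.
Qed.

(** With w the square root of z, the factor k w^k stays bounded, by the sum of the
    geometric series, and the other factor w^k tends to 0. *)
Lemma cvg_natM_expr (z : R) : 0 <= z < 1 -> (fun k => k%:R * z ^+ k) @ \oo --> 0.
Proof.
move=> /andP[z0 z1]; pose w := Num.sqrt z.
have w0 : 0 <= w by exact: sqrtr_ge0.
have w1 : w < 1 by rewrite -sqrtr1 ltr_sqrt.
have zE : z = w ^+ 2 by rewrite sqr_sqrtr.
have bound k : k%:R * w ^+ k <= (1 - w)^-1.
  rewrite -[leRHS]mul1r ler_pdivlMr ?subr_gt0 //.
  suff : k%:R * w ^+ k * (1 - w) <= 1 - w ^+ k.
    by move/le_trans; apply; rewrite gerBl exprn_ge0.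
  elim: k => [|k IH]; first by rewrite !mul0r subrr.
  have wk0 : 0 <= w ^+ k by exact: exprn_ge0.
  have wk1 : w ^+ k <= 1 by rewrite exprn_ile1 // ltW.
  have {}IH := ler_wpM2l w0 IH.
  have : 0 <= (1 - w) * (1 - w * w ^+ k).
    by rewrite mulr_ge0 ?subr_ge0 ?(ltW w1) // mulr_ile1 // ltW.
  move: IH; rewrite -natr1 exprS; move: (w ^+ k) => y; lra.
apply: (@squeeze_cvgr _ _ _ _ (fun _ => 0) (fun k => (1 - w)^-1 * w ^+ k)).
- apply: nearW => k; rewrite mulr_ge0 ?exprn_ge0 //= zE -exprM.
  by rewrite mul2n -addnn exprD mulrA ler_wpM2r ?exprn_ge0.
- exact: cvg_cst.
- by apply: cvg_geometric; rewrite ger0_norm.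
Qed.

(** Polynomials in u that converge to the indicator of u < 1/2 on [0, 1],
    including at the endpoint 1/2: since the exponent is k 2^k and not just 2^k, the
    value at 1/2 tends to 0. *)
Definition step k (u : R) := (1 - u ^+ k) ^+ (k * 2 ^ k).

Lemma step_itv k (u : R) : 0 <= u <= 1 -> 0 <= step k u <= 1.
Proof.
move=> /andP[u0 u1]; rewrite /step exprn_ge0 ?exprn_ile1 //.
- by rewrite subr_ge0 exprn_ile1.
- by rewrite gerBl exprn_ge0.
- by rewrite subr_ge0 exprn_ile1.
Qed.

Lemma step_cvg (u : R) : 0 <= u <= 1 -> (fun k => step k u) @ \oo --> ((u < 2^-1)%R%:R : R).
Proof.
move=> u01; have /andP[u0 u1] := u01.
have uk k : 0 <= u ^+ k <= 1 by rewrite exprn_ge0 //= exprn_ile1.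
have E k : (k * 2 ^ k)%:R * u ^+ k = k%:R * (2 * u) ^+ k :> R.
  by rewrite natrM natrX -mulrA -exprMn.
have [u2|u2] := ltP u 2^-1.
  apply: (@squeeze_cvgr _ _ _ _ (fun k => 1 - k%:R * (2 * u) ^+ k) (fun _ => 1)).
  - apply: nearW => k; rewrite -E bernoulli_sub //=.
    by have /andP[] := step_itv k u01.
  - rewrite -[X in _ --> X](subr0 (1 : R)); apply: cvgB; first exact: cvg_cst.
    by apply: cvg_natM_expr; lra.
  - exact: cvg_cst.
apply: (@squeeze_cvgr _ _ _ _ (fun _ => 0) (@harmonic R)); last exact: cvg_harmonic.
  apply: nearW => k; have /andP[-> _] /= := step_itv k u01.
  apply: (le_trans (bernoulli_inv _ (uk k))).
  rewrite E /= lef_pV2 ?posrE //; last first.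
    by rewrite ltr_wpDr // mulr_ge0 // exprn_ge0 // mulr_ge0.
  rewrite -natr1 addrC lerD2l ler_peMr // exprn_ege1 //; lra.
exact: cvg_cst.
Qed.

End StepFunctions.

(** * Measurability of polynomial functions *)

Section Measures.
Context {R : realType} {n : nat}.
Local Notation C := R[i].
Local Notation T := (borelRn R n).
Local Notation Xv i := (mpolyX C (mnm1 i)).
Local Notation RtoC := (real_complex R).
Implicit Types (f g P : mpoly n C) (i : 'I_n) (x y : 'rV[R]_n) (r : R).

Lemma open_borel (U : set 'rV[R]_n) : open U -> measurable (U : set T).
Proof. exact: sub_sigma_algebra. Qed.

Lemma measurable_coord i : measurable_fun setT (fun x : T => x 0 i : R).
Proof.
apply: (measurability _ (RGenOpens.measurableE R)) => _ [_ [a [b ->]] <-].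
rewrite setTI; apply: open_borel.
have /continuousP : continuous (fun x : 'rV[R]_n => x 0 i).
  by case: n i => [[]//|n' i]; exact: coord_continuous.
by apply; exact: interval_open.
Qed.

Definition RePoly f : T -> R := fun x => complex.Re (ceval f x).
Definition ImPoly f : T -> R := fun x => complex.Im (ceval f x).

Lemma ReZD (c z w : C) : complex.Re (c * z + w) =
  complex.Re c * complex.Re z - complex.Im c * complex.Im z + complex.Re w.
Proof. by case: c z w => [? ?] [? ?] [? ?]. Qed.

Lemma ImZD (c z w : C) : complex.Im (c * z + w) =
  complex.Re c * complex.Im z + complex.Im c * complex.Re z + complex.Im w.
Proof. by case: c z w => [? ?] [? ?] [? ?]. Qed.

Lemma cevalZD (c : C) f g x : ceval (c *: f + g) x = c * ceval f x + ceval g x.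
Proof. by rewrite /ceval mevalD mevalZ. Qed.

Lemma cevalM f g x : ceval (f * g) x = ceval f x * ceval g x.
Proof. by rewrite /ceval mevalM. Qed.

Lemma cevalXv i x : ceval (Xv i) x = (x 0 i)%:C%C.
Proof. by rewrite /ceval mevalXU. Qed.

Lemma measurable_poly f : measurable_fun setT (RePoly f) /\ measurable_fun setT (ImPoly f).
Proof.
have Q0 : measurable_fun setT (RePoly 0) /\ measurable_fun setT (ImPoly 0).
  have E x : ceval 0 x = 0 :> C by rewrite /ceval meval0.
  split; [rewrite (_ : RePoly 0 = cst 0)|rewrite (_ : ImPoly 0 = cst 0)] => //;
    by apply/funext => x; rewrite /RePoly /ImPoly E.
have QD (c : C) u v : measurable_fun setT (RePoly u) /\ measurable_fun setT (ImPoly u) ->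
    measurable_fun setT (RePoly v) /\ measurable_fun setT (ImPoly v) ->
    measurable_fun setT (RePoly (c *: u + v)) /\ measurable_fun setT (ImPoly (c *: u + v)).
  move=> [ru iu] [rv iv]; split.
    rewrite (_ : RePoly _ = fun x =>
      complex.Re c * RePoly u x - complex.Im c * ImPoly u x + RePoly v x); last first.
      by apply/funext => x; rewrite /RePoly cevalZD ReZD.
    apply: measurable_funD => //; apply: measurable_funB; apply: measurable_funM => //;
      exact: measurable_cst.
  rewrite (_ : ImPoly _ = fun x =>
    complex.Re c * ImPoly u x + complex.Im c * RePoly u x + ImPoly v x); last first.
    by apply/funext => x; rewrite /ImPoly cevalZD ImZD.
  apply: measurable_funD => //; apply: measurable_funD; apply: measurable_funM => //;
    exact: measurable_cst.
elim/(@mpoly_span R n): f => [|c u v hu hv|m]; [exact: Q0|exact: QD|].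
elim/(@mnm_ind n): m => [|i m [rm im]].
  rewrite mpolyX0; have E x : ceval 1 x = 1 :> C by rewrite /ceval meval1.
  split; [rewrite (_ : RePoly 1 = cst 1)|rewrite (_ : ImPoly 1 = cst 0)] => //;
    by apply/funext => x; rewrite /RePoly /ImPoly E.
have E x : ceval (mpolyX C (mnm_add (mnm1 i) m)) x = (x 0 i)%:C%C * ceval (mpolyX C m) x + 0.
  by rewrite mpolyXD cevalM cevalXv addr0.
have mi := measurable_coord i; split.
  rewrite (_ : RePoly _ = fun x => x 0 i * RePoly (mpolyX C m) x); first exact: measurable_funM.
  by apply/funext => x; rewrite /RePoly E ReZD /= mul0r subr0 addr0.
rewrite (_ : ImPoly _ = fun x => x 0 i * ImPoly (mpolyX C m) x); first exact: measurable_funM.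
by apply/funext => x; rewrite /ImPoly E ImZD /= mul0r !addr0.
Qed.

Lemma measurable_zero_set_ball (P : mpoly n C) r : measurable (zero_set_ball P r : set T).
Proof.
have [mR mI] := measurable_poly P.
have -> : zero_set_ball P r = RePoly P @^-1` [set 0] `&` ImPoly P @^-1` [set 0] `&`
    (fun x => Num.sqrt (\sum_i x 0 i ^+ 2)) @^-1` [set` `]-oo, r]].
  apply/seteqP; split => x /=; rewrite /RePoly /ImPoly /eucl_norm in_itv /=.
    by move=> [-> xr].
  by move=> [[p1 p2] xr]; split => //; case: (ceval P x) p1 p2 => a b /= -> ->.
rewrite -[X in measurable X]setTI; apply: measurableI => //.
apply: measurableI.
  by apply: measurableI; rewrite -[X in measurable X]setTI; [exact: mR|exact: mI].
rewrite -[X in measurable X]setTI.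
have : measurable_fun setT (@Num.sqrt R \o (fun x : T => \sum_i (x 0 i : R) ^+ 2)).
  apply: measurableT_comp.
    by apply: continuous_measurable_fun; exact: sqrt_continuous.
  apply: measurable_sum => i; apply: measurable_funX; exact: measurable_coord.
by apply => //.
Qed.

Lemma zero_set_ball_coord (P : mpoly n C) r x i : zero_set_ball P r x -> `|x 0 i| <= r.
Proof.
move=> [_]; apply: le_trans; rewrite /eucl_norm -sqrtr_sqr ler_sqrt; last first.
  by apply: sumr_ge0 => k _; exact: sqr_ge0.
by rewrite (bigD1 i) //= lerDl sumr_ge0 // => k _; exact: sqr_ge0.
Qed.

(** * Approximation of indicators by polynomials *)

Definition cube (r : R) : set 'rV[R]_n := [set x | forall i, `|x 0 i| <= r].

Definition real_valued f (q : 'rV[R]_n -> R) := forall x, ceval f x = RtoC (q x).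

Lemma real_valued_cst (c : R) : real_valued (mpolyC n (RtoC c)) (fun _ => c).
Proof. by move=> x; rewrite /ceval mevalC. Qed.

Lemma real_valuedM f g q q' : real_valued f q -> real_valued g q' ->
  real_valued (f * g) (fun x => q x * q' x).
Proof. by move=> Ef Eg x; rewrite cevalM Ef Eg rmorphM. Qed.

Lemma real_valuedD f g q q' : real_valued f q -> real_valued g q' ->
  real_valued (f + g) (fun x => q x + q' x).
Proof. by move=> Ef Eg x; rewrite /ceval mevalD -!/(ceval _ _) Ef Eg rmorphD. Qed.

Lemma real_valuedB f g q q' : real_valued f q -> real_valued g q' ->
  real_valued (f - g) (fun x => q x - q' x).
Proof. by move=> Ef Eg x; rewrite /ceval mevalB -!/(ceval _ _) Ef Eg rmorphB. Qed.

Lemma real_valuedX f q k : real_valued f q -> real_valued (f ^+ k) (fun x => q x ^+ k).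
Proof. by move=> Ef x; rewrite /ceval rmorphXn /= -/(ceval _ _) Ef -rmorphXn. Qed.

Lemma real_valued_Xv i : real_valued (Xv i) (fun x => x 0 i).
Proof. by move=> x; rewrite cevalXv. Qed.

(** The measure of such a set, for a finite measure on the cube, is a limit of
    moments; and these sets are closed under intersection. *)
Definition approximable (r : R) (A : set 'rV[R]_n) :=
  exists (f : nat -> mpoly n C) (q : nat -> 'rV[R]_n -> R),
  (forall k, real_valued (f k) (q k)) /\
  (forall x, cube r x -> (forall k, 0 <= q k x <= 1) /\
     (fun k => q k x) @ \oo --> (\1_A x : R)).

Lemma approximableT r : approximable r setT.
Proof.
exists (fun _ => mpolyC n (RtoC 1)), (fun _ _ => 1); split => [k|x _].
  exact: real_valued_cst.
split => [_|]; first by rewrite ler01 lexx.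
by rewrite indicT; exact: cvg_cst.
Qed.

Lemma approximableI r A B : approximable r A -> approximable r B ->
  approximable r (A `&` B).
Proof.
move=> [f [q [Ef qA]]] [f' [q' [Ef' qB]]].
exists (fun k => f k * f' k), (fun k x => q k x * q' k x); split => [k|x xr].
  exact: real_valuedM.
have [q01 qc] := qA _ xr; have [q01' qc'] := qB _ xr; split => [k|].
  have /andP[a0 a1] := q01 k; have /andP[b0 b1] := q01' k.
  by rewrite mulr_ge0 //= mulr_ile1.
by rewrite indicI; exact: cvgM.
Qed.

(** An affine map sends the values of g on the cube into [1/4, 3/4], and the
    threshold 0 to 1/2. *)
Lemma approximable_lt0 r (M : R) g (gam : 'rV[R]_n -> R) : 0 < M ->
  real_valued g gam -> (forall x, cube r x -> `|gam x| <= M) ->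
  approximable r [set x | gam x < 0].
Proof.
move=> M0 Eg gM; pose a := (4 * M)^-1; have a0 : 0 < a by rewrite invr_gt0 mulr_gt0.
pose u x := 2^-1 + a * gam x.
pose U := mpolyC n (RtoC 2^-1) + mpolyC n (RtoC a) * g.
have EU : real_valued U u.
  by apply: real_valuedD; [|apply: real_valuedM => //]; exact: real_valued_cst.
exists (fun k => (mpolyC n (RtoC 1) - U ^+ k) ^+ (k * 2 ^ k)), (fun k x => step k (u x)).
split => [k|x xr].
  apply: real_valuedX; apply: real_valuedB; first exact: real_valued_cst.
  exact: real_valuedX.
have u01 : 0 <= u x <= 1.
  have aM : a * M = 4^-1 by rewrite /a invfM -mulrA mulVf ?mulr1 // gt_eqF.
  have : `|a * gam x| <= a * M.
    by rewrite normrM (gtr0_norm a0) ler_wpM2l ?(ltW a0) // gM.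
  rewrite aM ler_norml /u; lra.
split => [k|]; first exact: step_itv.
have -> : \1_[set x | gam x < 0] x = (u x < 2^-1)%R%:R :> R.
  rewrite indicE /u; congr (nat_of_bool _)%:R.
  apply/idP/idP => [/set_mem /= g0|]; first by rewrite gtrDl pmulr_rlt0.
  by rewrite gtrDl pmulr_rlt0 // => g0; exact: mem_set.
exact: step_cvg.
Qed.

Definition box (c : 'I_n -> R) (e : R) : set 'rV[R]_n :=
  [set x | forall i, `|x 0 i - c i| < e].

(** Squaring makes the defining inequalities polynomial. *)
Lemma boxE c (e : R) : 0 < e -> box c e =
  [set x | forall i, i \in enum 'I_n -> (x 0 i - c i) ^+ 2 - e ^+ 2 < 0].
Proof.
move=> e0; have E (z : R) : (z ^+ 2 - e ^+ 2 < 0) = (`|z| < e).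
  by rewrite subr_lt0 -(real_normK (num_real z)) ltr_pXn2r ?nnegrE // ltW.
apply/seteqP; split => x /= H i => [_|]; first by rewrite E.
by rewrite -E H // mem_enum.
Qed.

Lemma approximable_box r c (e : R) : 0 < e -> approximable r (box c e).
Proof.
move=> e0; rewrite boxE //.
suff H (s : seq 'I_n) : approximable r
    [set x : 'rV[R]_n | forall i, i \in s -> (x 0 i - c i) ^+ 2 - e ^+ 2 < 0].
  exact: H.
elim: s => [|i s IH].
  rewrite (_ : [set x | _] = setT); first exact: approximableT.
  by apply/seteqP; split.
rewrite (_ : [set x | _] = [set x : 'rV[R]_n | (x 0 i - c i) ^+ 2 - e ^+ 2 < 0] `&`
  [set x : 'rV[R]_n | forall i, i \in s -> (x 0 i - c i) ^+ 2 - e ^+ 2 < 0]); last first.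
  apply/seteqP; split => x /=.
    by move=> H; split => [|k ks]; apply: H; rewrite inE ?eqxx ?ks ?orbT.
  by move=> [xi xs] k; rewrite inE => /predU1P[->|/xs].
apply: approximableI => //.
apply: (@approximable_lt0 _ ((`|r| + `|c i|) ^+ 2 + e ^+ 2)
  ((Xv i - mpolyC n (RtoC (c i))) ^+ 2 - mpolyC n (RtoC (e ^+ 2)))).
- by rewrite ltr_wpDl ?sqr_ge0 // exprn_gt0.
- apply: real_valuedB; last exact: real_valued_cst.
  apply: real_valuedX; apply: real_valuedB; last exact: real_valued_cst.
  exact: real_valued_Xv.
- move=> x xr; rewrite (le_trans (ler_normB _ _)) // !normrX lerD //; last first.
    by rewrite ger0_norm // ltW.
  rewrite ler_pXn2r ?nnegrE ?addr_ge0 // (le_trans (ler_normB _ _)) // lerD2r.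
  exact: (le_trans (xr i) (ler_norm _)).
Qed.

Lemma measurable_box c e : measurable (box c e : set T).
Proof.
have -> : box c e = \bigcap_(i in [set: 'I_n]) [set x | `|x 0 i - c i| < e].
  by apply/seteqP; split => x H i => [_|]; exact: H.
apply: fin_bigcap_measurable; first exact: finite_finset.
move=> i _.
have mi : measurable_fun setT (fun x : T => `|x 0 i - c i|).
  apply: measurableT_comp => //; apply: measurable_funB => //.
  exact: measurable_coord.
have := mi measurableT [set` `]-oo, e[] (measurable_itv _); rewrite setTI.
by congr measurable; apply/seteqP; split => x; rewrite /= in_itv.
Qed.

(** A countable basis of boxes, with rational centres and radii 1 / (j + 1). A
    number that codes no pair gives the box of radius 1 at the origin. *)
Definition rational_box (k : nat) : set 'rV[R]_n :=
  let: (c, j) := odflt ([ffun=> 0], 0%N) (unpickle k : option ({ffun 'I_n -> rat} * nat)) in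
  box (fun i => ratr (c i)) j.+1%:R^-1.

Lemma rational_boxP k : exists c e, 0 < e /\ rational_box k = box c e.
Proof.
rewrite /rational_box; case: (odflt _ _) => c j.
by exists (fun i => ratr (c i)), j.+1%:R^-1; rewrite invr_gt0.
Qed.

Lemma rational_box_basis (U : set 'rV[R]_n) x : open U -> U x ->
  exists k, rational_box k x /\ rational_box k `<=` U.
Proof.
rewrite openE => /[apply] /nbhs_ballP[e /= e0 xU].
have e20 : 0 < e / 2 by rewrite divr_gt0.
have [j] := ltr_add_invr e20; rewrite add0r => je.
pose d : R := j.+1%:R^-1; have d0 : 0 < d by rewrite invr_gt0.
have /choice[c Hc] : forall i : 'I_n, exists q : rat, `|x 0 i - ratr q| < d.
  move=> i; have [|q] := @rat_in_itvoo R (x 0 i - d) (x 0 i + d); first by lra.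
  rewrite in_itv /= => /andP[q1 q2]; exists q; rewrite ltr_norml; lra.
exists (pickle ([ffun i => c i], j)); rewrite /rational_box pickleK /=.
split => [i|y By]; first by rewrite ffunE.
apply: xU; split => // k i; rewrite ord1 -ball_normE /=.
have := By i; rewrite ffunE => yc; have := Hc i; rewrite -/d in yc je *.
move: yc; rewrite !ltr_norml; lra.
Qed.

(** * Measures determined by their moments *)

Implicit Types (m : {finite_measure set T -> \bar R}).

Lemma RePoly_bounded r f : exists M : R, forall x, cube r x ->
  `|RePoly f x| <= M /\ `|ImPoly f x| <= M.
Proof.
elim/(@mpoly_span R n): f => [|c f g [M HM] [N HN]|m].
- by exists 0 => x _; rewrite /RePoly /ImPoly /ceval meval0 normr0.
- exists ((`|complex.Re c| + `|complex.Im c|) * M + N) => x xr.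
  rewrite /RePoly /ImPoly cevalZD ReZD ImZD.
  have [a1 a2] := HM _ xr; have [b1 b2] := HN _ xr.
  have a3 := le_trans (normr_ge0 _) a1.
  split; rewrite (le_trans (ler_normD _ _)) // lerD // mulrDl.
    by rewrite (le_trans (ler_normB _ _)) // !normrM lerD // ler_wpM2l.
  by rewrite (le_trans (ler_normD _ _)) // !normrM lerD // ler_wpM2l.
elim/(@mnm_ind n): m => [|i m [M HM]].
  by exists 1 => x _; rewrite /RePoly /ImPoly mpolyX0 /ceval meval1 /= normr1 normr0.
exists (r * M) => x xr; have [a1 a2] := HM _ xr.
have E : ceval (mpolyX C (mnm_add (mnm1 i) m)) x = (x 0 i)%:C%C * ceval (mpolyX C m) x + 0.
  by rewrite mpolyXD cevalM cevalXv addr0.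
rewrite /RePoly /ImPoly E ReZD ImZD /= !mul0r subr0 !addr0 !normrM.
by split; apply: ler_pM => //; exact: xr.
Qed.

Definition carried r m (K : set T) :=
  [/\ measurable K, K `<=` cube r & m (~` K) = 0%E].

Lemma carried_ae r m K (Q : T -> Prop) : carried r m K ->
  (forall x, K x -> Q x) -> {ae m, forall x, Q x}.
Proof.
move=> [mK _ K0] KQ; exists (~` K); split => //; first exact: measurableC.
by apply: subsetC => x; exact: KQ.
Qed.

Lemma carried_integrable r m K (h : T -> R) (M : R) : carried r m K ->
  measurable_fun setT h -> (forall x, cube r x -> `|h x| <= M) ->
  m.-integrable setT (EFin \o h).
Proof.
move=> [mK Kr K0] mh hM; have mKC := measurableC mK.
apply/(negligible_integrable mKC) => //; first exact/measurable_EFinP.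
rewrite setTD setCK; apply: measurable_bounded_integrable => //.
- by rewrite ltey_eq fin_num_measure.
- exact: measurable_funTS.
- exists M; split; first exact: num_real.
  by move=> N MN x Kx /=; rewrite (le_trans (hM _ (Kr _ Kx))) // ltW.
Qed.

Lemma carried_approximable r m K A : carried r m K -> measurable (A : set T) ->
  forall (f : nat -> mpoly n C) (q : nat -> 'rV[R]_n -> R),
  (forall k, real_valued (f k) (q k)) ->
  (forall x, cube r x -> (forall k, 0 <= q k x <= 1) /\
     (fun k => q k x) @ \oo --> (\1_A x : R)) ->
  (fun k => \int[m]_x (RePoly (f k) x))%R @ \oo --> fine (m A).
Proof.
move=> mK mA f q Ef qA.
have RE k x : RePoly (f k) x = q k x by rewrite /RePoly Ef.
have [_ Kr _] := mK.
have [] := @dominated_convergence _ _ _ m setT measurableT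
  (fun k x => (RePoly (f k) x)%:E) (fun x => (\1_A x)%:E) (cst 1%E).
- by move=> k; apply/measurable_EFinP; case: (measurable_poly (f k)).
- by apply/measurable_EFinP; exact: measurable_indic.
- apply: (carried_ae mK) => x Kx _; have [_ qc] := qA _ (Kr _ Kx).
  by apply: cvg_EFin; [exact: nearW|under eq_fun do rewrite /= RE].
- exact: finite_measure_integrable_cst.
- apply: (carried_ae mK) => x Kx k _; have [q01 _] := qA _ (Kr _ Kx).
  by rewrite RE /= lee_fin ger0_norm; have /andP[] := q01 k.
move=> _ _; rewrite integral_indic // setIT -[X in _ --> X]fineK; last exact: fin_num_measure.
by move/fine_cvg.
Qed.

(** Approximable measurable sets form a pi-system that contains a countable basis
    of the topology. Two measures on each side leave room for the Jordan
    decompositions of two charges. *)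
Lemma moments_unique r m1 m2 m3 m4 K1 K2 K3 K4 :
  carried r m1 K1 -> carried r m2 K2 -> carried r m3 K3 -> carried r m4 K4 ->
  (forall f, \int[m1]_x RePoly f x + \int[m2]_x RePoly f x =
             \int[m3]_x RePoly f x + \int[m4]_x RePoly f x)%R ->
  forall A, measurable A -> (m1 A + m2 A = m3 A + m4 A)%E.
Proof.
move=> c1 c2 c3 c4 eqm.
pose G := [set A : set T | measurable A /\ approximable r A].
have GT : G setT by split; [exact: measurableT|exact: approximableT].
have Gbox k : G (rational_box k).
  have [c [e [e0 ->]]] := rational_boxP k.
  by split; [exact: measurable_box|exact: approximable_box].
have mG : measurable = <<s G >>.
  apply/seteqP; split => A; last first.
    by apply: smallest_sub; [exact: sigma_algebra_measurable|move=> B []].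
  apply: smallest_sub; first exact: smallest_sigma_algebra.
  move=> U oU.
  have -> : U = \bigcup_k (if `[< rational_box k `<=` U >] then rational_box k else set0).
    apply/seteqP; split => [x Ux|x [k _]]; last by case: asboolP => // kU /kU.
    have [k [kx kU]] := rational_box_basis oU Ux.
    by exists k => //; case: asboolP.
  have [s0 _ sU] := smallest_sigma_algebra setT G; apply: sU => k.
  by case: asboolP => _; [exact: sub_sigma_algebra|exact: s0].
move=> A mA; rewrite -!measure_addE.
apply: (measure_unique G (fun _ => setT)) => //.
- move=> B D [mB aB] [mD aD]; split; [exact: measurableI|exact: approximableI].
- by rewrite bigcup_const //; exists 0%N.
- move=> B [mB [f [q [Ef qB]]]].
  suff E : (m1 B + m2 B = m3 B + m4 B)%E.
    exact: (etrans (measure_addE m1 m2 B) (etrans E (esym (measure_addE m3 m4 B)))).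
  have l1 := carried_approximable c1 mB Ef qB.
  have l2 := carried_approximable c2 mB Ef qB.
  have l3 := carried_approximable c3 mB Ef qB.
  have l4 := carried_approximable c4 mB Ef qB.
  rewrite -(fineK (fin_num_measure m1 B mB)) -(fineK (fin_num_measure m2 B mB)).
  rewrite -(fineK (fin_num_measure m3 B mB)) -(fineK (fin_num_measure m4 B mB)).
  rewrite -!EFinD; congr (_%:E).
  have l12 := cvgD l1 l2; have l34 := cvgD l3 l4.
  have <- := cvg_lim (@Rhausdorff R) (l12 _); have <- := cvg_lim (@Rhausdorff R) (l34 _).
  by congr (lim (_ @ \oo)); apply/funext => k /=; exact: eqm.
- move=> _; apply: (eq_ind_r (fun z => z < +oo)%E _ (measure_addE m1 m2 setT)).
  by rewrite lte_add_pinfty // ltey_eq fin_num_measure.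
Qed.

(** * Signed measures *)

Implicit Types (mu nu : {charge set T -> \bar R}).
Local Notation pos mu := (jordan_pos (hahnP mu)).
Local Notation neg mu := (jordan_neg (hahnP mu)).

(** The complement of the support is a countable union of null boxes. *)
Lemma charge_support_null mu (K : set T) : measurable K -> charge_support mu `<=` K ->
  pos mu (~` K) = 0%E /\ neg mu (~` K) = 0%E.
Proof.
move=> mK suppK.
pose N k : set T := if charge_variation (hahnP mu) (rational_box k) == 0%E
  then rational_box k else set0.
have mbox k : measurable (rational_box k : set T).
  by have [c [e [e0 ->]]] := rational_boxP k; exact: measurable_box.
have mN k : measurable (N k) by rewrite /N; case: ifP => // _; exact: mbox.
have cover : ~` K `<=` \bigcup_k N k.
  move=> x Kx; have /existsNP[U /not_implyP[oU /not_implyP[Ux /negP]]] : ~ charge_support mu x.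
    by move=> /suppK.
  rewrite negbK => /eqP U0; have [k [kx kU]] := rational_box_basis oU Ux.
  exists k => //; rewrite /N ifT //; apply/eqP.
  have mU := open_borel oU.
  apply/eqP; rewrite eq_le; apply/andP; split; last by rewrite adde_ge0.
  by rewrite -U0 leeD // le_measure ?inE //; exact: mbox.
have null (m : {measure set T -> \bar R}) : (forall A, m A <= charge_variation (hahnP mu) A)%E ->
    m (~` K) = 0%E.
  move=> mle; apply/eqP; rewrite eq_le measure_ge0 andbT.
  have := measure_sigma_subadditive m mN (measurableC mK) cover.
  move=> /le_trans; apply; rewrite eseries0 // => k _ _.
  rewrite /N; case: ifP => [/eqP k0|_]; last exact: measure0.
  by apply/eqP; rewrite eq_le measure_ge0 andbT -k0 mle.
split; apply: null => A.
  by rewrite leeDl.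
by rewrite leeDr.
Qed.

Lemma charge_carried P r mu : charge_support mu `<=` zero_set_ball P r ->
  carried r (pos mu) (zero_set_ball P r) /\ carried r (neg mu) (zero_set_ball P r).
Proof.
move=> supp; have mK := measurable_zero_set_ball P r.
have [p0 q0] := charge_support_null mK supp.
by split; split => // x Kx i; exact: zero_set_ball_coord Kx.
Qed.

Lemma charge_fin mu A : measurable A -> mu A = ((fine (pos mu A))%:E - (fine (neg mu A))%:E)%E.
Proof.
move=> mA; rewrite !fineK ?fin_num_measure //.
by rewrite (jordan_decomp (hahnP mu) mA) /cadd /= cscaleN1.
Qed.

(** Moving the negative parts to the other side gives an equality between
    positive measures, to which the theory of integration applies. *)
Lemma eq_chargeP mu nu : eq_charge mu nu <->
  (forall A, measurable A -> pos mu A + neg nu A = pos nu A + neg mu A)%E.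
Proof.
split => H A mA; have := H A mA.
  rewrite (charge_fin mu mA) (charge_fin nu mA) => /eqP; rewrite -!EFinB eqe => /eqP E.
  rewrite -(fineK (fin_num_measure (pos mu) A mA)) -(fineK (fin_num_measure (neg nu) A mA)).
  rewrite -(fineK (fin_num_measure (pos nu) A mA)) -(fineK (fin_num_measure (neg mu) A mA)).
  rewrite -!EFinD; congr (_%:E); lra.
rewrite -(fineK (fin_num_measure (pos mu) A mA)) -(fineK (fin_num_measure (neg nu) A mA)).
rewrite -(fineK (fin_num_measure (pos nu) A mA)) -(fineK (fin_num_measure (neg mu) A mA)).
rewrite -!EFinD => /eqP; rewrite eqe => /eqP E.
rewrite (charge_fin mu mA) (charge_fin nu mA) -!EFinB; congr (_%:E); lra.
Qed.

Lemma eq_charge_integral mu nu (h : T -> R) : eq_charge mu nu ->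
  (pos mu).-integrable setT (EFin \o h) -> (neg mu).-integrable setT (EFin \o h) ->
  (pos nu).-integrable setT (EFin \o h) -> (neg nu).-integrable setT (EFin \o h) ->
  charge_integral mu h = charge_integral nu h.
Proof.
move=> /eq_chargeP E h1 h2 h3 h4.
have : (\int[measure_add (pos mu) (neg nu)]_x (h x)%:E =
        \int[measure_add (pos nu) (neg mu)]_x (h x)%:E)%E.
  apply: eq_measure_integral => A mA _.
  exact: (etrans (measure_addE _ _ A) (etrans (E A mA) (esym (measure_addE _ _ A)))).
have fin (m : {measure set T -> \bar R}) : m.-integrable setT (EFin \o h) ->
    (\int[m]_x (EFin \o h) x = (\int[m]_x h x)%R%:E)%E.
  by move=> hm; rewrite /Rintegral fineK //; exact: integrable_fin_num.
move=> Eadd.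
have := etrans (esym (integral_measure_add measurableT h1 h4))
  (etrans Eadd (integral_measure_add measurableT h3 h2)).
rewrite !fin // -!EFinD => /eqP; rewrite eqe => /eqP.
rewrite /charge_integral; lra.
Qed.

Section Carried.
Context (r : R) (P : mpoly n C).

Lemma carried_integrable_poly (m : {finite_measure set T -> \bar R}) f :
  carried r m (zero_set_ball P r) ->
  m.-integrable setT (EFin \o RePoly f) /\ m.-integrable setT (EFin \o ImPoly f).
Proof.
move=> cm; have [M HM] := RePoly_bounded r f; have [mR mI] := measurable_poly f.
by split; apply: (carried_integrable (M := M) cm) => // x /HM[].
Qed.

Lemma Rintegral_lincomb (m : {finite_measure set T -> \bar R}) (a b : R) (h1 h2 h3 : T -> R) :
  m.-integrable setT (EFin \o h1) -> m.-integrable setT (EFin \o h2) ->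
  m.-integrable setT (EFin \o h3) ->
  \int[m]_x (a * h1 x + b * h2 x + h3 x) =
  a * (\int[m]_x h1 x) + b * (\int[m]_x h2 x) + \int[m]_x h3 x.
Proof.
move=> i1 i2 i3.
have j1 : m.-integrable setT (EFin \o (fun x => a * h1 x)).
  exact: (integrableZl measurableT a i1).
have j2 : m.-integrable setT (EFin \o (fun x => b * h2 x)).
  exact: (integrableZl measurableT b i2).
rewrite RintegralD //; last first.
  exact: (integrableD measurableT j1 j2).
by rewrite RintegralD // !RintegralZl.
Qed.

Lemma carried_Rintegral_mul0 (m : {finite_measure set T -> \bar R}) f :
  carried r m (zero_set_ball P r) ->
  \int[m]_x RePoly (P * f) x = 0 /\ \int[m]_x ImPoly (P * f) x = 0.
Proof.
move=> cm; have [mR mI] := measurable_poly (P * f).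
have Z x : zero_set_ball P r x -> ceval (P * f) x = 0.
  by move=> [Px _]; rewrite cevalM Px mul0r.
have H (h : T -> R) : measurable_fun setT h -> (forall x, zero_set_ball P r x -> h x = 0) ->
    \int[m]_x h x = 0.
  move=> mh hZ; rewrite /Rintegral (ae_eq_integral (cst 0%E)) //.
  - by rewrite integral0.
  - exact/measurable_EFinP.
  - by apply: (carried_ae cm) => x Kx _ /=; rewrite hZ.
by split; apply: H => // x /Z E; rewrite /RePoly /ImPoly E.
Qed.

Context (mu : {charge set T -> \bar R}).
Context (supp : charge_support mu `<=` zero_set_ball P r).

Lemma charge_cintegral_linear (c : C) f g :
  charge_cintegral mu (ceval (c *: f + g)) =
  c * charge_cintegral mu (ceval f) + charge_cintegral mu (ceval g).
Proof.
have [cp cn] := charge_carried supp.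
have [pf1 pf2] := carried_integrable_poly f cp; have [pg1 pg2] := carried_integrable_poly g cp.
have [nf1 nf2] := carried_integrable_poly f cn; have [ng1 ng2] := carried_integrable_poly g cn.
rewrite /charge_cintegral /charge_integral.
have -> : (fun x => complex.Re (ceval (c *: f + g) x)) =
    (fun x => complex.Re c * RePoly f x + (- complex.Im c) * ImPoly f x + RePoly g x).
  by apply/funext => x; rewrite cevalZD ReZD mulNr.
have -> : (fun x => complex.Im (ceval (c *: f + g) x)) =
    (fun x => complex.Re c * ImPoly f x + complex.Im c * RePoly f x + ImPoly g x).
  by apply/funext => x; rewrite cevalZD ImZD.
rewrite !Rintegral_lincomb //; case: c => a b /=.
rewrite -[fun x => complex.Re (ceval f x)]/(RePoly f) -[fun x => complex.Im (ceval f x)]/(ImPoly f).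
rewrite -[fun x => complex.Re (ceval g x)]/(RePoly g) -[fun x => complex.Im (ceval g x)]/(ImPoly g).
move: (Rintegral (pos mu) setT (RePoly f)) (Rintegral (neg mu) setT (RePoly f))
  (Rintegral (pos mu) setT (ImPoly f)) (Rintegral (neg mu) setT (ImPoly f))
  (Rintegral (pos mu) setT (RePoly g)) (Rintegral (neg mu) setT (RePoly g))
  (Rintegral (pos mu) setT (ImPoly g)) (Rintegral (neg mu) setT (ImPoly g)) => *.
by apply/eqP; rewrite eq_complex /=; apply/andP; split; apply/eqP; ring.
Qed.

Lemma charge_cintegral_zero f : charge_cintegral mu (ceval (P * f)) = 0.
Proof.
have [cp cn] := charge_carried supp.
have [p1 p2] := carried_Rintegral_mul0 f cp; have [n1 n2] := carried_Rintegral_mul0 f cn.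
by rewrite /charge_cintegral /charge_integral p1 p2 n1 n2 !subrr.
Qed.

End Carried.
End Measures.

Theorem theorem1 (R : realType) (n : nat) (P : mpoly n R[i]) (P_neq0 : P != 0)
    (r : R) (r_gt0 : 0 < r) (mu nu : {charge set (borelRn R n) -> \bar R})
    (mu_supp : charge_support mu `<=` zero_set_ball P r)
    (nu_supp : charge_support nu `<=` zero_set_ball P r) :
  eq_charge mu nu <->
  (forall h : mpoly n R[i], polyharmonic_space (max_product_degree P) h ->
     charge_cintegral mu (ceval h) = charge_cintegral nu (ceval h)).
Proof.
have [mup mun] := charge_carried mu_supp; have [nup nun] := charge_carried nu_supp.
split => [E h _|E].
  have [a1 b1] := carried_integrable_poly h mup; have [a2 b2] := carried_integrable_poly h mun.
  have [a3 b3] := carried_integrable_poly h nup; have [a4 b4] := carried_integrable_poly h nun.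
  by rewrite /charge_cintegral !(eq_charge_integral E).
pose ell f := charge_cintegral mu (ceval f) - charge_cintegral nu (ceval f).
have ell0 f : ell f = 0.
  apply: (fischer_functional_eq0 _ P_neq0).
  - move=> c g h; rewrite /ell (charge_cintegral_linear mu_supp).
    rewrite (charge_cintegral_linear nu_supp).
    move: (charge_cintegral mu (ceval g)) (charge_cintegral mu (ceval h))
      (charge_cintegral nu (ceval g)) (charge_cintegral nu (ceval h)) => *.
    ring.
  - move=> g; rewrite /ell (charge_cintegral_zero mu_supp).
    by rewrite (charge_cintegral_zero nu_supp) subrr.
  - by move=> h /E; rewrite /ell => ->; rewrite subrr.
apply/eq_chargeP; apply: (moments_unique mup nun nup mun) => f.
have /eqP := ell0 f; rewrite subr_eq0 => /eqP/(congr1 (@complex.Re R)).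
rewrite /= /charge_integral -!/(RePoly f); lra.
Qed.
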